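(* Let $\mathbf Y_{ni}$ be the vector time series described in the context and let $\mathbf v_n,\mathbf w_n\in\mathbb R^{d_n}$, $n\ge1$, satisfy $\sup_n\max\{\|\mathbf v_n\|_{\ell_1},\|\mathbf w_n\|_{\ell_1}\}<\infty$ and $\mathbf v_n'\mathbf w_n\ge\underline c>0$ for all $n$ and some constant $\underline c$. Assume the rate condition described in the context and $\inf_{n\ge1}\sigma_{tr,n}^2>0$, where $\sigma_{tr,n}^2=d_n^{-2}\sum_{i,j=1}^{d_n}\beta_n^2(i,j)$. Let $\overline B_n(t)=n^{-1/2}B_n(nt)=(\overline B_n(t)_j)_{j=0}^{d_n}$, $t\in[0,1]$, with $B_n$ the Brownian motion in the rate condition. Then, on the new probability space, the difference between the shrinkage estimator with estimated optimal weight $\widehat W_n^*$ and the oracle estimator with optimal weight $W_n^*$ satisfies $$\big|\mathbf v_n'(\widehat{\boldsymbol\Sigma}_n^s(\widehat W_n^* )-\widehat{\boldsymbol\Sigma}_n^s(W_n^* ))\mathbf w_n\big|=|\widehat W_n^*-W_n^*|\Big(O(1)+O\big(\overline B_n(1)_0n^{-1/2}\big)+O\Big(n^{-1/2}d_n^{-1/2}\sum_{i=1}^{d_n}\overline B_n(1)_i\Big)+o(n^{-1/2})\Big)$$ as $n\to\infty$, a.s. (here $O(X_n)$ denotes a term bounded in absolute value by a constant multiple of $|X_n|$).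
   Context: Model. $\{\epsilon_t\}_{t\in\mathbb Z}$ are independent mean-zero real random variables (not necessarily identically distributed) with $\sup_tE|\epsilon_t|^{4+\delta}<\infty$ for some $\delta>0$ and such that $n^{-1}\sum_{i=1}^nE(\epsilon_i^r)$ converges for $r=2,3,4$. Put $\sigma_k^2=E\epsilon_k^2$, $\gamma_k=E\epsilon_k^4$. For positive integers $d_n$, $n\ge 1$, let $\mathbf Y_{ni}=(Y_{ni}^{(1)},\dots,Y_{ni}^{(d_n)})'$ with $Y_{ni}^{(\nu)}=\sum_{j\ge0}c_{nj}^{(\nu)}\epsilon_{i-j}$ for $i\ge 0$, where for some $\theta\in(0,1/2)$ there is a constant $c$ with $\sup_n\max_{1\le\nu\le d_n}|c_{nj}^{(\nu)}|^2\le c\,\max(j,1)^{-3/2-\theta}$ for all $j\ge0$. No relation between $n$ and $d_n$ is assumed. $\mathbf e_j$ is the $j$th unit vector of $\mathbb R^{d_n}$ and $I_n$ the $d_n\times d_n$ identity. Shrinkage. $\widehat{\boldsymbol\Sigma}_n=\frac1n\sum_{i=1}^n\mathbf Y_{ni}\mathbf Y_{ni}'$, $\boldsymbol\Sigma_n=E\widehat{\boldsymbol\Sigma}_n$, $\mu_n=d_n^{-1}\operatorname{tr}\boldsymbol\Sigma_n$, $\widehat\mu_n=d_n^{-1}\operatorname{tr}\widehat{\boldsymbol\Sigma}_n$, $\widehat{\boldsymbol\Sigma}_n^s(W)=(1-W)\widehat{\boldsymbol\Sigma}_n+W\widehat\mu_nI_n$. With the scaled Frobenius norm $\|A\|_F^{*2}=d_n^{-1}\operatorname{tr}(AA')$,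 the optimal weight is $W_n^*=E\|\widehat{\boldsymbol\Sigma}_n-\boldsymbol\Sigma_n\|_F^{*2}\,/\,E\|\mu_nI_n-\widehat{\boldsymbol\Sigma}_n\|_F^{*2}$ and its estimator is $$\widehat W_n^*=\frac{(nd_n)^{-1}\sum_{1\le i,j\le d_n}\widehat\sigma_n^2(i,j)}{\|\widehat\mu_nI_n-\widehat{\boldsymbol\Sigma}_n\|_F^{*2}},\qquad \widehat\sigma_n^2(i,j)=\widehat\Gamma_n^{(i,j)}(0)+2\sum_{\tau=1}^{m}w_{m\tau}\widehat\Gamma_n^{(i,j)}(\tau),$$ where $\widehat\Gamma_n^{(i,j)}(\tau)=\frac1n\sum_{t=1}^{n-\tau}[Y_{nt}^{(i)}Y_{nt}^{(j)}-\widehat\kappa_n(i,j)][Y_{n,t+\tau}^{(i)}Y_{n,t+\tau}^{(j)}-\widehat\kappa_n(i,j)]$, $\widehat\kappa_n(i,j)=\frac1n\sum_{t=1}^nY_{nt}^{(i)}Y_{nt}^{(j)}$, $m=m_n$ is a sequence of lag truncation constants and $\{w_{m\tau}\}$ are window weights. Covariance parameters. For $\mathbf v,\mathbf w\in\mathbb R^{d_n}$ put $f_{0,j}^{(n)}(\mathbf v,\mathbf w)=\sum_{\nu,\mu}v_\nu w_\mu c_{nj}^{(\nu)}c_{nj}^{(\mu)}$, $f_{l,j}^{(n)}(\mathbf v,\mathbf w)=\sum_{\nu,\mu}v_\nu w_\mu[c_{nj}^{(\nu)}c_{n,j+l}^{(\mu)}+c_{nj}^{(\mu)}c_{n,j+l}^{(\nu)}]$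 for $l\ge1$, and $\widetilde f_{l,i}^{(n)}=\sum_{j\ge i}f_{l,j}^{(n)}$. Then $\beta_n^2(\mathbf v,\mathbf w,\tilde{\mathbf v},\tilde{\mathbf w})$ is the real number (whose existence is part of the standing framework) for which there is a constant $K$ such that for all $n'\ge 1$, $m'\ge0$ $$\Big|\widetilde f_{0,0}^{(n)}(\mathbf v,\mathbf w)\widetilde f_{0,0}^{(n)}(\tilde{\mathbf v},\tilde{\mathbf w})\sum_{j=1}^{n'}(\gamma_{m'+j}-\sigma_{m'+j}^4)+\sum_{j=1}^{n'}\sum_{l=1}^{j-1}\widetilde f_{j-l,0}^{(n)}(\mathbf v,\mathbf w)\widetilde f_{j-l,0}^{(n)}(\tilde{\mathbf v},\tilde{\mathbf w})\sigma_{m'+j}^2\sigma_{m'+l}^2-n'\beta_n^2\Big|\le K(n')^{1-\theta}.$$ Write $\beta_n^2(i,j)=\beta_n^2(\mathbf e_i,\mathbf e_i,\mathbf e_j,\mathbf e_j)$. Rate condition. Consider the $L_n=d_n+1$ pairs $(\mathbf v_n^{(0)},\mathbf w_n^{(0)})=(\mathbf v_n,\mathbf w_n)$, $(\mathbf v_n^{(j)},\mathbf w_n^{(j)})=(\mathbf e_j,\mathbf e_j)$, $1\le j\le d_n$, and $D_{nt}=\sum_{1\le i\le t}\big((\mathbf v_n^{(j)\prime}\mathbf Y_{ni})(\mathbf w_n^{(j)\prime}\mathbf Y_{ni})-E[(\mathbf v_n^{(j)\prime}\mathbf Y_{ni})(\mathbf w_n^{(j)\prime}\mathbf Y_{ni})]\big)_{j=0}^{d_n}$.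 The condition is: on some (new) probability space there are versions (with unchanged distribution) of the processes and, for each $n$, a mean-zero $(d_n+1)$-dimensional Brownian motion $B_n$ with $E(B_n(s)_jB_n(t)_k)=\min(s,t)L_n^{-1}\beta_n^2(\mathbf v_n^{(j)},\mathbf w_n^{(j)},\mathbf v_n^{(k)},\mathbf w_n^{(k)})$ such that a.s. $\|L_n^{-1/2}D_{nt}-B_n(t)\|_{\mathbb R^{L_n}}\le C_nt^{1/2-\lambda_n}$ for all $t\ge0$, with a.s. finite $C_n$ and $\lambda_n>0$ satisfying $C_nn^{-\lambda_n}=o(1)$ a.s. as $n\to\infty$. *)

(* Defs.v *)
From HB Require Import structures.
From mathcomp Require Import all_boot all_order all_algebra finmap.
From mathcomp Require Import all_classical all_reals all_analysis.

Set Implicit Arguments.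
Unset Strict Implicit.
Unset Printing Implicit Defensive.

Import Order.TTheory GRing.Theory Num.Theory.
Import numFieldNormedType.Exports.

Local Open Scope classical_set_scope.
Local Open Scope ring_scope.

Section Probability.
Context {R : realType} {disp : measure_display} {T : measurableType disp}.
Variable P : probability T R.

Definition mean (X : T -> R) : R := fine ('E_P[X])%E.

Definition sigma_generated {J : Type} (X : J -> T -> R) : set (set T) :=
  <<s \bigcup_(j in [set: J])
        preimage_set_system [set: T] (X j) (@measurable _ R) >>.

Definition mutually_independent {I : choiceType} (F : I -> set (set T)) : Prop :=
  forall (J : {fset I}) (E : I -> set T),
    (forall i, i \in J -> F i (E i)) ->
    P (\bigcap_(i in [set` J]) E i) = (\prod_(i <- J) fine (P (E i)))%:E.

(* The law N(mu, v), v >= 0 being the variance. The case v = 0 must be treated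
   separately, because normal_prob mu 0 is the uniform law on [0, 1]. *)
Definition gaussian_law (mu v : R) (A : set R) : \bar R :=
  if v == 0 then (\d_mu A)%E else normal_prob mu (Num.sqrt v) A.

(* X has the (possibly degenerate) law N(0, S). *)
Definition centered_gaussian_vector {L : nat} (S : 'M[R]_L)
    (X : 'I_L -> T -> R) : Prop :=
  forall (a : 'cV[R]_L) (A : set R), measurable A ->
    0 <= (a^T *m S *m a) 0 0 /\
    P ((fun x => \sum_j a j 0 * X j x) @^-1` A)
      = gaussian_law 0 ((a^T *m S *m a) 0 0) A.

(* A mean-zero L-dimensional Brownian motion, with an arbitrary covariance
   matrix S at time 1. The process is only considered at times t >= 0. *)
Definition brownian_motion {L : nat} (B : R -> 'I_L -> {RV P >-> R}) : Prop :=
  exists S : 'M[R]_L,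
  [/\ {ae P, forall x, forall j, B 0 j x = 0},
      {ae P, forall x, forall j,
         {within [set t : R | 0 <= t], continuous (fun t => B t j x)}},
      forall t : nat -> R, 0 <= t 0%N -> nondecreasing_seq t ->
        mutually_independent (fun k : nat =>
          sigma_generated (fun j x => B (t k.+1) j x - B (t k) j x)) &
      forall s t : R, 0 <= s -> s <= t ->
        centered_gaussian_vector ((t - s) *: S)
          (fun j x => B t j x - B s j x)].

End Probability.

Definition same_distribution {R : realType} {disp disp' : measure_display}
    {T : measurableType disp} {T' : measurableType disp'}
    (P : probability T R) (P' : probability T' R) {I : choiceType}
    (X : I -> T -> R) (X' : I -> T' -> R) : Prop :=
  forall (J : {fset I}) (A : I -> set R), (forall i, measurable (A i)) ->
    P (\bigcap_(i in [set` J]) (X i @^-1` A i)) =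
    P' (\bigcap_(i in [set` J]) (X' i @^-1` A i)).

Definition l1_norm {R : realType} {d : nat} (v : 'cV[R]_d) : R :=
  \sum_i `|v i 0|.

Definition l2_norm {R : realType} {d : nat} (x : 'I_d -> R) : R :=
  Num.sqrt (\sum_i x i ^+ 2).

Definition scaled_frob2 {R : realType} {d : nat} (A : 'M[R]_d) : R :=
  d%:R^-1 * \tr (A *m A^T).

(* Sample statistics of an observed path y 1, ..., y n of d-vectors. *)
Section Statistics.
Context {R : realType} {d : nat}.
Implicit Types (y : nat -> 'cV[R]_d) (n : nat).

Definition sample_cov n y : 'M[R]_d :=
  n%:R^-1 *: \sum_(1 <= i < n.+1) y i *m (y i)^T.

Definition mean_trace (A : 'M[R]_d) : R := d%:R^-1 * \tr A.

Definition shrinkage n y (W : R) : 'M[R]_d :=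
  (1 - W) *: sample_cov n y + (W * mean_trace (sample_cov n y)) *: 1%:M.

Definition kappa_hat n y (i j : 'I_d) : R :=
  n%:R^-1 * \sum_(1 <= t < n.+1) y t i 0 * y t j 0.

Definition Gamma_hat n y (i j : 'I_d) (tau : nat) : R :=
  n%:R^-1 * \sum_(1 <= t < (n - tau).+1)
    (y t i 0 * y t j 0 - kappa_hat n y i j) *
    (y (t + tau)%N i 0 * y (t + tau)%N j 0 - kappa_hat n y i j).

(* m is the lag truncation, win m tau the window weights. *)
Definition sigma2_hat (win : nat -> nat -> R) (m n : nat) y (i j : 'I_d) : R :=
  Gamma_hat n y i j 0 +
  2 * \sum_(1 <= tau < m.+1) win m tau * Gamma_hat n y i j tau.

Definition W_hat (win : nat -> nat -> R) (m n : nat) y : R :=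
  ((n * d)%:R^-1 * \sum_i \sum_j sigma2_hat win m n y i j) /
  scaled_frob2 ((mean_trace (sample_cov n y)) *: 1%:M - sample_cov n y).

End Statistics.

Section Oracle.
Context {R : realType} {disp : measure_display} {T : measurableType disp}.
Variable P : probability T R.

Definition expected_cov {d : nat} n (Y : T -> nat -> 'cV[R]_d) : 'M[R]_d :=
  \matrix_(i, j) mean P (fun x => sample_cov n (Y x) i j).

Definition W_opt {d : nat} n (Y : T -> nat -> 'cV[R]_d) : R :=
  mean P (fun x => scaled_frob2 (sample_cov n (Y x) - expected_cov n Y)) /
  mean P (fun x => scaled_frob2 (mean_trace (expected_cov n Y) *: 1%:M
                          - sample_cov n (Y x))).

End Oracle.

(* The coefficients f_{l,j} and the asymptotic covariance parameter, for a
   fixed sample size; cf nu j is the j-th coefficient of coordinate nu. *)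
Section CovarianceParameters.
Context {R : realType} {d : nat}.
Variable cf : 'I_d -> nat -> R.
Implicit Types v w : 'cV[R]_d.

Definition fcoef v w (l j : nat) : R :=
  if l == 0%N then
    \sum_nu \sum_mu v nu 0 * w mu 0 * (cf nu j * cf mu j)
  else
    \sum_nu \sum_mu v nu 0 * w mu 0 *
      (cf nu j * cf mu (j + l)%N + cf mu j * cf nu (j + l)%N).

Definition ftilde v w (l i : nat) : R :=
  limn (fun N => \sum_(i <= j < N) fcoef v w l j).

(* b = beta^2(v, w, v', w'); s2 and g4 are the second and fourth moments of
   the innovations. *)
Definition is_beta2 (theta : R) (s2 g4 : nat -> R) v w v' w' (b : R) : Prop :=
  exists K : R, forall n m : nat, (0 < n)%N ->
    `| ftilde v w 0 0 * ftilde v' w' 0 0 *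
         (\sum_(1 <= j < n.+1) (g4 (m + j)%N - s2 (m + j)%N ^+ 2))
       + \sum_(1 <= j < n.+1) \sum_(1 <= l < j)
           ftilde v w (j - l) 0 * ftilde v' w' (j - l) 0 *
             (s2 (m + j)%N * s2 (m + l)%N)
       - n%:R * b |
    <= K * n%:R `^ (1 - theta).

End CovarianceParameters.

Definition unit_vec {R : realType} {d : nat} (i : 'I_d) : 'cV[R]_d :=
  delta_mx i 0.

(* The d + 1 weighting vectors: v at index 0, then the unit vectors. *)
Definition augment {R : realType} {d : nat} (v : 'cV[R]_d) (j : 'I_d.+1)
    : 'cV[R]_d :=
  if unlift ord0 j is Some i then unit_vec i else v.

Section RateCondition.
Context {R : realType} {disp : measure_display} {T : measurableType disp}.
Variable P : probability T R.

Definition obs {d : nat} (Y : nat -> 'I_d -> T -> R) (x : T) (i : nat)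
    : 'cV[R]_d :=
  \col_nu Y i nu x.

Definition bilin {d : nat} (v w y : 'cV[R]_d) : R :=
  (v^T *m y) 0 0 * (w^T *m y) 0 0.

Definition Dproc {d : nat} (Y : nat -> 'I_d -> T -> R) (v w : 'cV[R]_d)
    (t : R) (j : 'I_d.+1) (x : T) : R :=
  \sum_(1 <= i < (Num.truncn t).+1)
    (bilin (augment v j) (augment w j) (obs Y x i) -
     mean P (fun x' => bilin (augment v j) (augment w j) (obs Y x' i))).

Definition rate_condition (dim : nat -> nat)
    (Y : forall n, nat -> 'I_(dim n) -> {RV P >-> R})
    (beta2 : forall n, 'cV[R]_(dim n) -> 'cV[R]_(dim n) ->
                       'cV[R]_(dim n) -> 'cV[R]_(dim n) -> R)
    (v w : forall n, 'cV[R]_(dim n))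
    (B : forall n, R -> 'I_(dim n).+1 -> {RV P >-> R})
    (C : nat -> {RV P >-> R}) (lambda : nat -> R) : Prop :=
  [/\ forall n, (0 < n)%N ->
        brownian_motion (B n) /\
        forall (s t : R) (j k : 'I_(dim n).+1), 0 <= s -> 0 <= t ->
          'E_P[(fun x => B n s j x * B n t k x)%R]%E =
          (Num.min s t * (dim n).+1%:R^-1 *
           beta2 n (augment (v n) j) (augment (w n) j)
                   (augment (v n) k) (augment (w n) k))%:E,
      forall n, (0 < n)%N -> 0 < lambda n,
      forall n, (0 < n)%N ->
        {ae P, forall x, forall t : R, 0 <= t ->
          l2_norm (fun j => (Num.sqrt (dim n).+1%:R)^-1 *
                            Dproc (Y n) (v n) (w n) t j x - B n t j x)
          <= C n x * t `^ (1 / 2 - lambda n)} &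
      {ae P, forall x, (fun n => C n x * n%:R `^ (- lambda n)) @ \oo --> 0}].

Definition Bbar {L : nat} (n : nat) (B : R -> 'I_L -> {RV P >-> R})
    (t : R) (j : 'I_L) (x : T) : R :=
  (Num.sqrt n%:R)^-1 * B (n%:R * t) j x.

End RateCondition.

(* Main.v *)
Require Import Defs.
From HB Require Import structures.
From mathcomp Require Import all_boot all_order all_algebra finmap.
From mathcomp Require Import all_classical all_reals all_analysis.
From mathcomp Require Import measurable_realfun ring lra zify.

Set Implicit Arguments.
Unset Strict Implicit.
Unset Printing Implicit Defensive.

Import Order.TTheory GRing.Theory Num.Theory.
Import numFieldNormedType.Exports.

Local Open Scope classical_set_scope.
Local Open Scope ring_scope.

(** The two shrinkage estimators differ by [(What - Wopt) *: (mu I - S)], where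
[S] is the sample covariance matrix and [mu] its mean trace, so the claim is about
the size of the single random variable [Q_n = v' (mu I - S) w]. It holds because
[Q_n] is almost surely bounded by a constant for all large [n]: the [O(1)] term
carries [Q_n] up to that constant, and the excess, which is nonzero for finitely
many [n] only, is an [o(n^(-1/2))].

[n Q_n] is a quadratic form in the observations whose weights have an [l^1] norm
bounded independently of [n] and of the dimension. Written in terms of the
innovations, it is a quadratic form [sum b u v e_u e_v]. The squared
coefficients of the processes decay like [j^(-3/2 - theta)]; hence their
autocovariances are square summable, and both the trace of [b] and its squared
Frobenius norm are [O(n)] ([envelope_form_trace], [envelope_form_sqr]). So the
mean of [n Q_n] is [O(n)] and its variance is [O(n)].

A variance of that order only gives [P(|Q_n| > K) = O(1/n)], which is not
summable. Summability is needed, as nothing is known of the joint law of the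
processes for different [n]. The moments of order [4 + delta] give a little more:
with [q = 1 + k > 1], the innovations have [4 q] moments, and the centred
quadratic form satisfies [E |.|^(2 q) <= C n^q] ([quadratic_moment]), whence
[P(|Q_n| > K) <= C n^(- q)] ([process_form_tail]). This is a bound on the law of
one [Q_n], so it passes to the second probability space, and the Borel-Cantelli
lemma concludes ([ae_eventually_bounded]).

The moment inequality is of Burkholder type. Ordering the innovations makes the
centred quadratic form a sum of martingale differences
([quadratic_form_increments]). Adding the difference [x] to the past sum [s]
costs, by a Taylor inequality for [|s + x|^(2 q)] ([evenpow_drift]), a factor
[1 + 16 l] on the moment of [s] and a multiple of [l^(- k)] times the moment of
[x], the linear term having conditional mean zero. Choosing [l] proportional to
the share of the step in the total of the squared coefficients keeps the product
of the factors bounded. Conditioning is done with the Tonelli theorem, after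
replacing the new innovation by an independent copy ([integral_decoupling]). *)

(** * A Taylor inequality for even powers *)

Section PowerInequality.
Context {R : realType}.
Implicit Types q s x y l k t : R.

(** This is [|x|^(2 q)]. Written through the square it is multiplicative, and
[t `^ k] with [q = 1 + k] is concave in [t = x ^+ 2]. *)
Definition evenpow q x : R := (x ^+ 2) `^ q.

Lemma evenpow_ge0 q x : 0 <= evenpow q x.
Proof. exact: powR_ge0. Qed.

Lemma evenpow0 q : 0 < q -> evenpow q 0 = 0.
Proof. by move=> q0; rewrite /evenpow expr0n powR0 // gt_eqF. Qed.

Lemma evenpowM q x y : evenpow q (x * y) = evenpow q x * evenpow q y.
Proof. by rewrite /evenpow exprMn powRM // sqr_ge0. Qed.

Lemma evenpow_le q x y : 0 <= q -> `|x| <= `|y| -> evenpow q x <= evenpow q y.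
Proof.
move=> q0 xy; apply: ge0_ler_powR => //; rewrite ?nnegrE ?sqr_ge0 //.
by rewrite -(real_normK (num_real x)) -(real_normK (num_real y)) lerXn2r ?nnegrE.
Qed.

Lemma evenpow_two q : 0 <= q <= 2 -> evenpow q 2 <= 16.
Proof.
move=> /andP[q0 q2]; rewrite /evenpow -natrX.
have := @ler_powR _ (4%:R : R) _ q 2 q2; rewrite powR_mulrn // -natrX; apply.
by rewrite ler1n.
Qed.

Lemma evenpowD q x y : 0 <= q <= 2 ->
  evenpow q (x + y) <= 16 * (evenpow q x + evenpow q y).
Proof.
move=> q02; have q0 : 0 <= q by case/andP: q02.
wlog xy : x y / `|x| <= `|y| => [h|].
  have [/h //|/ltW /h] := leP `|x| `|y|.
  by rewrite addrC [evenpow q y + _]addrC.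
apply: (@le_trans _ _ (16 * evenpow q y)).
  apply: (@le_trans _ _ (evenpow q (2 * y))).
    apply: evenpow_le => //; rewrite normrM ger0_norm //.
    by rewrite (le_trans (ler_normD _ _)) // mulr_natl mulr2n lerD2r.
  by rewrite evenpowM ler_wpM2r ?evenpow_ge0 ?evenpow_two.
by rewrite ler_pM2l // lerDr evenpow_ge0.
Qed.

(** A concave function lies below its tangent, here at 1. This is the Young
inequality between [t `^ k] and 1. *)
Lemma powR_le_affine k t : 0 < k <= 1 -> 0 <= t -> t `^ k <= 1 + k * (t - 1).
Proof.
move=> /andP[k0]; rewrite le_eqVlt => /predU1P[-> t0|k1 t0].
  by rewrite powRr1 //; lra.
have h := @conjugate_powR _ (t `^ k) 1 k^-1 (1 - k)^-1
  (powR_ge0 _ _) ler01.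
have := h; rewrite !invr_gt0 subr_gt0 !invrK -powRrM divff ?gt_eqF // powRr1 //.
by rewrite powR1 mulr1 => /(_ k0 k1 (subrKC _ _)) /le_trans; apply; lra.
Qed.

(** For [|x| <= 1] the factor [((1 + x) ^+ 2) `^ k] is below its tangent, and the
cubic and quartic terms are absorbed by [x ^+ 2]; for [|x| > 1] the last term
dominates alone, as [|1 + x| <= 2 |x|]. *)
Lemma evenpow_1D k x : 0 < k <= 1 ->
  evenpow (1 + k) (1 + x) <=
  1 + 2 * (1 + k) * x + 16 * (x ^+ 2 + evenpow (1 + k) x).
Proof.
move=> k01; have /andP[k0 k1] := k01.
have q02 : 0 <= 1 + k <= 2 by lra.
have [x1|x1] := leP `|x| 1.
  have h : evenpow (1 + k) (1 + x) <= (1 + x) ^+ 2 * (1 + k * ((1 + x) ^+ 2 - 1)).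
    rewrite {1}/evenpow powRD; last by rewrite gt_eqF // addr_gt0.
    rewrite powRr1 ?sqr_ge0 // ler_wpM2l ?sqr_ge0 //.
    by apply: powR_le_affine => //; rewrite sqr_ge0.
  apply: (le_trans h).
  have e0 := evenpow_ge0 (1 + k) x.
  have : x ^+ 2 * (4 * k * x + k * x ^+ 2) <= x ^+ 2 * 5.
    rewrite ler_wpM2l ?sqr_ge0 //; move: x1; rewrite ler_norml => /andP[a b].
    by nra.
  have := sqr_ge0 x; nra.
have h : evenpow (1 + k) (1 + x) <= 16 * evenpow (1 + k) x.
  apply: (@le_trans _ _ (evenpow (1 + k) (2 * x))).
    apply: evenpow_le; first by lra.
    rewrite normrM ger0_norm // (le_trans (ler_normD _ _)) // normr1.
    by move: (ltW x1); lra.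
  by rewrite evenpowM ler_wpM2r ?evenpow_ge0 ?evenpow_two.
have : 0 <= (16 - (1 + k) ^+ 2) * x ^+ 2 by rewrite mulr_ge0 ?sqr_ge0 //; nra.
have := sqr_ge0 (1 + (1 + k) * x); lra.
Qed.

(** [evenpow_1D] at [x / s], with the mixed term [(s ^+ 2) `^ k * x ^+ 2] split
between the powers of [s] and of [x]. The parameter [l] is left free, so that in a
sum with many terms the factors [1 + 16 * l] can be made to have a bounded
product. The middle term is linear in [x] and disappears on taking conditional
expectations. *)
Lemma evenpow_drift k l s x : 0 < k <= 1 -> 0 < l ->
  evenpow (1 + k) (s + x) <=
  (1 + 16 * l) * evenpow (1 + k) s
  + 2 * (1 + k) * (s * (s ^+ 2) `^ k) * x
  + 16 * (1 + l `^ (- k)) * evenpow (1 + k) x.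
Proof.
move=> k01 l0; have /andP[k0 k1] := k01.
have [->|s0] := eqVneq s 0.
  rewrite add0r evenpow0; last by lra.
  rewrite mul0r !mulr0 mul0r !add0r ler_peMl ?evenpow_ge0 //.
  by have := powR_ge0 l (- k); lra.
have s2 : 0 < s ^+ 2 by rewrite exprn_even_gt0.
have es : evenpow (1 + k) s = s ^+ 2 * (s ^+ 2) `^ k.
  by rewrite /evenpow powRD ?powRr1 // ?ltW // (gt_eqF s2) implybT.
have h := evenpow_1D (x / s) k01.
have /(ler_wpM2l (evenpow_ge0 (1 + k) s)) := h.
rewrite -evenpowM [s * (1 + _)]mulrDr mulr1 mulrCA divff // mulr1.
move=> /le_trans; apply.
set A := (s ^+ 2) `^ k in es *.
have A0 : 0 <= A by exact: powR_ge0.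
have e1 : evenpow (1 + k) s * (2 * (1 + k) * (x / s)) = 2 * (1 + k) * (s * A) * x.
  by rewrite es; field.
have e2 : evenpow (1 + k) s * evenpow (1 + k) (x / s) = evenpow (1 + k) x.
  by rewrite -evenpowM mulrCA divff // mulr1.
have e3 : evenpow (1 + k) s * (x / s) ^+ 2 = A * x ^+ 2.
  by rewrite es; field.
have split4 (a b c d : R) : a * (1 + b + 16 * (c + d))
    = a + a * b + 16 * (a * c + a * d) by ring.
rewrite split4 e1 e2 e3.
(* Young: either x ^+ 2 is at most l * s ^+ 2, or s ^+ 2 is below x ^+ 2 / l *)
have young : A * x ^+ 2 <= l * evenpow (1 + k) s + l `^ (- k) * evenpow (1 + k) x.
  have [xs|sx] := leP (x ^+ 2) (l * s ^+ 2).
    have : A * x ^+ 2 <= l * evenpow (1 + k) s.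
      by rewrite es mulrA mulrC ler_wpM2r.
    have := mulr_ge0 (powR_ge0 l (- k)) (evenpow_ge0 (1 + k) x); lra.
  have x2 : 0 < x ^+ 2 by apply: le_lt_trans sx; rewrite mulr_ge0 // ltW.
  have ex : evenpow (1 + k) x = x ^+ 2 * (x ^+ 2) `^ k.
    by rewrite /evenpow powRD ?powRr1 // ?ltW // (gt_eqF x2) implybT.
  have hA : A <= l `^ (- k) * (x ^+ 2) `^ k.
    have : (l * s ^+ 2) `^ k <= (x ^+ 2) `^ k.
      apply: ge0_ler_powR; rewrite ?nnegrE ?sqr_ge0 //; [exact: ltW| |exact: ltW].
      by rewrite mulr_ge0 ?sqr_ge0 // ltW.
    rewrite (powRM _ (ltW l0) (sqr_ge0 s)) -/A => h1.
    by rewrite powRN ler_pdivlMl ?powR_gt0.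
  have := mulr_ge0 (ltW l0) (evenpow_ge0 (1 + k) s).
  have := ler_wpM2r (ltW x2) hA.
  rewrite ex [_ * (x ^+ 2 * _)]mulrCA [x ^+ 2 * _]mulrC; lra.
lra.
Qed.

End PowerInequality.

(** * Independence and decoupling *)

Section Cylinders.
Context {R : realType} {I : choiceType} {U : Type}.
Variables (X : I -> U -> R) (S : pred I).

(** The pi-system on which both independence and equality in law are given. *)
Definition cylinders : set (set U) :=
  [set A | exists (J : {fset I}) (E : I -> set R),
     [/\ forall i, i \in J -> S i, forall i, measurable (E i) &
         A = \bigcap_(i in [set` J]) (X i @^-1` E i)]].

Lemma cylinders_setT : cylinders setT.
Proof.
exists fset0, (fun _ => setT); split => //.
by apply/seteqP; split => // x _ i; rewrite /= in_fset0.
Qed.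

Lemma cylinders_setI : setI_closed cylinders.
Proof.
move=> _ _ [J [E [JS mE ->]]] [J' [E' [JS' mE' ->]]].
exists (J `|` J')%fset, (fun i => (if i \in J then E i else setT)
  `&` (if i \in J' then E' i else setT)); split.
- by move=> i; rewrite in_fsetU => /orP[/JS|/JS'].
- by move=> i; apply: measurableI; case: ifP.
- apply/seteqP; split => [x [h h'] i /= _|x h].
    split; case: ifP => // iJ; [exact: (h i)|exact: (h' i)].
  split=> i /= iJ; have [] := h i; rewrite /= ?in_fsetU ?iJ ?orbT //.
Qed.

Lemma cylinders_preimage i (E : set R) : S i -> measurable E ->
  cylinders (X i @^-1` E).
Proof.
move=> Si mE; exists [fset i]%fset, (fun _ => E); split => //.
  by move=> j; rewrite in_fset1 => /eqP ->.
apply/seteqP; split => [x h j /=|x]; first by rewrite in_fset1 => /eqP ->.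
by apply; rewrite /= in_fset1.
Qed.

End Cylinders.

Section Independence.
Context {R : realType} {disp : measure_display} {T : measurableType disp}.
Variable P : probability T R.

Lemma cylinders_measurable (I : choiceType) (X : I -> {RV P >-> R}) (S : pred I) :
  cylinders (fun i => X i : T -> R) S `<=` measurable.
Proof.
move=> _ [J [E [_ mE ->]]]; rewrite bigcap_fset.
elim/big_ind: _ => //; first exact: measurableI.
by move=> i _; rewrite -[_ @^-1` _]setTI; exact: measurable_funP.
Qed.

Variables (I : choiceType) (X : I -> {RV P >-> R}).
Hypothesis indep : mutually_independent P
  (fun i => sigma_generated (fun _ : unit => X i)).

Let indepE (J : {fset I}) (E : I -> set R) : (forall i, measurable (E i)) ->
  P (\bigcap_(i in [set` J]) X i @^-1` E i) =
  (\prod_(i <- J) fine (P (X i @^-1` E i)))%:E.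
Proof.
move=> mE; apply: indep => i _; apply: sub_sigma_algebra.
by exists tt => //; exists (E i) => //; rewrite setTI.
Qed.

(** For a fixed event of [X t], both sides are finite measures in [A] that agree on
a pi-system. *)
Lemma indep_cylinders (S : pred I) (t : I) (E : set R) (A : set T) :
  ~~ S t -> measurable E -> <<s cylinders (fun i => X i : T -> R) S >> A ->
  P (A `&` X t @^-1` E) = (P A * P (X t @^-1` E))%E.
Proof.
move=> St mE sA.
have mXE : measurable (X t @^-1` E).
  by rewrite -[_ @^-1` _]setTI; exact: measurable_funP.
have p0 : 0 <= fine (P (X t @^-1` E)) by rewrite fine_ge0.
pose m1 : {measure set T -> \bar R} := mrestr P mXE.
pose m2 : {measure set T -> \bar R} := mscale (NngNum p0) P.
have -> : P (A `&` X t @^-1` E) = m1 A by [].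
have -> : (P A * P (X t @^-1` E) = m2 A)%E.
  by rewrite /m2 /= /mscale /= fineK ?fin_num_measure // muleC.
apply: (g_sigma_algebra_measure_unique (cylinders (fun i => X i : T -> R) S)
  _ (fun=> setT)) => //.
- exact: cylinders_measurable.
- by move=> _; exact: cylinders_setT.
- by apply/seteqP; split => // x _; exists 0%N.
- exact: cylinders_setI.
- move=> _ [J [F [JS mF ->]]].
  have tJ : t \notin J by apply/negP => /JS; exact/negP.
  rewrite /m1 /m2 /= /mrestr /mscale /=.
  pose F' i := if i == t then E else F i.
  have mF' i : measurable (F' i) by rewrite /F'; case: ifP.
  have -> : \bigcap_(i in [set` J]) X i @^-1` F i `&` X t @^-1` E =
      \bigcap_(i in [set` (t |` J)%fset]) X i @^-1` F' i.
    apply/seteqP; split => [x [h1 h2] i /=|x h].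
      rewrite in_fset1U /F' => /orP[/eqP ->|iJ]; first by rewrite eqxx.
      have -> : (i == t) = false by apply/negbTE; apply: contraNneq tJ => <-.
      exact: h1.
    split=> [i /= iJ|].
      have := h i; rewrite /= in_fset1U iJ orbT /F' => /(_ isT).
      by have -> : (i == t) = false by apply/negbTE; apply: contraNneq tJ => <-.
    by have := h t; rewrite /= in_fset1U eqxx /F' eqxx; apply.
  rewrite !indepE // big_fsetU1 //= EFinM /F' eqxx fineK ?fin_num_measure //.
  congr (_ * _)%E; congr (_%:E); apply: eq_big_seq => i iJ /=.
  by have -> : (i == t) = false by apply/negbTE; apply: contraNneq tJ => <-.
- by move=> _; rewrite /m1 /= /mrestr (le_lt_trans (probability_le1 _ _)) ?ltry //;
   apply: measurableI.
Qed.

(** The sample space with the sigma-algebra of the variables in [S]: measurability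
on it expresses that a function depends on these variables only. *)
Definition pastType (S : pred I) :
    measurableType (cylinders (fun i => X i : T -> R) S).-sigma :=
  g_sigma_algebraType (cylinders (fun i => X i : T -> R) S).

Lemma measurable_past (S : pred I) i : S i ->
  measurable_fun [set: pastType S] (X i : pastType S -> R).
Proof.
move=> Si _ E mE; rewrite setTI; apply: sub_sigma_algebra.
exact: cylinders_preimage.
Qed.

Lemma past_id_measurable (S : pred I) :
  measurable_fun [set: T] (id : T -> pastType S).
Proof.
move=> _ A sA; rewrite setTI.
by apply: (smallest_sub (@sigma_algebra_measurable _ T) _ sA);
  exact: cylinders_measurable.
Qed.

(** Conditioning on the past without conditional expectations: [(past, X t)] has a
product law, and for nonnegative [F] the Tonelli theorem requires no
integrability. *)
Lemma integral_decoupling (S : pred I) (t : I)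
    (F : pastType S * R -> \bar R) : ~~ S t ->
  measurable_fun setT F -> (forall z, 0 <= F z)%E ->
  (\int[P]_x F (x, X t x) = \int[P]_x \int[P]_y F (x, X t y))%E.
Proof.
move=> St mF F0.
have mid : measurable_fun [set: T] (id : T -> pastType S).
  exact: past_id_measurable.
have mpair : measurable_fun [set: T] (fun x => ((x : pastType S), X t x)).
  by apply: measurable_fun_pair => //; exact: measurable_funP.
pose idX : {RV P >-> pastType S} := mfun_Sub (mem_set mid).
pose pairX : {RV P >-> (pastType S * R)%type} := mfun_Sub (mem_set mpair).
transitivity (\int[distribution P pairX]_z F z)%E.
  by rewrite ge0_integral_distribution.
transitivity (\int[distribution P idX \x distribution P (X t)]_z F z)%E.
  apply: eq_measure_integral => A mA _; apply/esym.
  apply: product_measure_unique => // C D mC mD.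
  exact: (@indep_cylinders S t D C).
rewrite fubini_tonelli1 // /fubini_F.
rewrite ge0_integral_distribution; first last.
- by move=> y; exact: integral_ge0.
- have := measurable_fun_fubini_tonelli_F (m2 := distribution P (X t)) F mF F0.
  exact.
apply: eq_integral => x _ /=.
rewrite ge0_integral_distribution //.
exact: measurableT_comp mF (pair1_measurable _).
Qed.

End Independence.

(** * A moment inequality for quadratic forms in independent variables *)

Section ConditionalStep.
Context {R : realType} {disp : measure_display} {T : measurableType disp}.
Variable P : probability T R.
Implicit Types f g : T -> R.

Lemma integrable_le_bound f a : measurable_fun setT f -> (forall x, 0 <= f x) ->
  (\int[P]_x (f x)%:E <= a%:E)%E -> P.-integrable setT (EFin \o f).
Proof.
move=> mf f0 fa; apply/integrableP; split; first exact/measurable_EFinP.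
rewrite (le_lt_trans _ (ltry a)) //; apply: le_trans fa.
rewrite le_eqVlt; apply/orP; left; apply/eqP; apply: eq_integral => x _ /=.
by rewrite ger0_norm.
Qed.

Lemma integrable_lin f g (a : R) : P.-integrable setT (EFin \o f) ->
  P.-integrable setT (EFin \o g) ->
  P.-integrable setT (EFin \o (fun x => f x + a * g x)).
Proof.
move=> fi gi.
exact: (integrableD measurableT fi (integrableZl measurableT a gi)).
Qed.

Lemma Rintegral_lin f g (a : R) : P.-integrable setT (EFin \o f) ->
  P.-integrable setT (EFin \o g) ->
  \int[P]_x (f x + a * g x) = \int[P]_x f x + a * \int[P]_x g x.
Proof.
move=> fi gi; rewrite RintegralD //; first by rewrite RintegralZl.
exact: (integrableZl measurableT a gi).
Qed.

Lemma measurable_evenpow (q : R) d (U : measurableType d) (h : U -> R) :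
  measurable_fun setT h -> measurable_fun setT (fun x => evenpow q (h x)).
Proof.
move=> mh; apply: (measurableT_comp (measurable_powR q)).
exact: measurable_funX.
Qed.

Variables (k K s2 : R) (X : {RV P >-> R}).
Hypothesis k01 : 0 < k <= 1.
Hypothesis X_int : P.-integrable setT (EFin \o X).
Hypothesis X_mean : \int[P]_x X x = 0.
Hypothesis X2_int : P.-integrable setT (EFin \o (fun x => X x ^+ 2)).
Hypothesis X2_mean : \int[P]_x (X x ^+ 2) = s2.
Hypothesis X_moment : (\int[P]_x (evenpow (1 + k) (X x))%:E <= K%:E)%E.
Hypothesis Z_moment :
  (\int[P]_x (evenpow (1 + k) (X x ^+ 2 - s2))%:E <= K%:E)%E.

Let mX : measurable_fun setT (X : T -> R).
Proof. exact: measurable_funP. Qed.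

Let mZ : measurable_fun setT (fun x => X x ^+ 2 - s2).
Proof. by apply: measurable_funB => //; exact: measurable_funX. Qed.

Let Rintegral_le f a : P.-integrable setT (EFin \o f) ->
  (\int[P]_x (f x)%:E <= a%:E)%E -> \int[P]_x f x <= a.
Proof.
move=> fi; rewrite -lee_fin /Rintegral fineK //.
exact: integrable_fin_num fi.
Qed.

(** Here [s] and [M] stand for the values of functions of the past, and the
increment is [X M + b (X^2 - s2)]; its mean is zero, so that the linear term of
[evenpow_drift] integrates to zero. *)
Lemma conditional_step (l s M b : R) : 0 < l -> l <= 1 ->
  (\int[P]_y (evenpow (1 + k) (s + X y * M + b * (X y ^+ 2 - s2)))%:E <=
   ((1 + 16 * l) * evenpow (1 + k) s +
    512 * K * l `^ (- k) * (evenpow (1 + k) M + evenpow (1 + k) b))%:E)%E.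
Proof.
move=> l0 l1; have /andP[k0 k1] := k01.
have lk1 : 1 <= l `^ (- k).
  rewrite powRN invf_ge1 ?powR_gt0 //.
  have := @ge0_ler_powR R k (ltW k0) l 1; rewrite powR1; apply => //.
    by rewrite nnegrE ltW.
  by rewrite nnegrE.
pose ev := evenpow (1 + k).
pose c1 := 2 * (1 + k) * (s * (s ^+ 2) `^ k).
pose c2 := 16 * (1 + l `^ (- k)).
have c20 : 0 <= c2 by rewrite mulr_ge0 // addr_ge0 // powR_ge0.
pose bound y := (1 + 16 * l) * ev s + (c1 * M) * X y
  + (- (c1 * b * s2)) * 1 + (c1 * b) * X y ^+ 2 + (c2 * 16 * ev M) * ev (X y)
  + (c2 * 16 * ev b) * ev (X y ^+ 2 - s2).
have i1 r : P.-integrable setT (EFin \o (fun=> r)).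
  exact: finite_measure_integrable_cst.
have i4 : P.-integrable setT (EFin \o (fun y => ev (X y))).
  apply: integrable_le_bound X_moment => [|x]; last exact: evenpow_ge0.
  exact: measurable_evenpow.
have i5 : P.-integrable setT (EFin \o (fun y => ev (X y ^+ 2 - s2))).
  apply: integrable_le_bound Z_moment => [|x]; last exact: evenpow_ge0.
  exact: measurable_evenpow.
have j1 := integrable_lin (c1 * M) (i1 ((1 + 16 * l) * ev s)) X_int.
have j2 := integrable_lin (- (c1 * b * s2)) j1 (i1 1).
have j3 := integrable_lin (c1 * b) j2 X2_int.
have j4 := integrable_lin (c2 * 16 * ev M) j3 i4.
have j5 := integrable_lin (c2 * 16 * ev b) j4 i5.
apply: (@le_trans _ _ (\int[P]_y (bound y)%:E)%E).
  apply: ge0_le_integral => //.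
  - by move=> x _; rewrite lee_fin evenpow_ge0.
  - apply/measurable_EFinP/measurable_evenpow; apply: measurable_funD.
      by apply: measurable_funD => //; exact: measurable_funM.
    exact: measurable_funM.
  - exact: (measurable_int _ j5).
  move=> y _; rewrite lee_fin -addrA.
  have h := evenpow_drift s (X y * M + b * (X y ^+ 2 - s2)) k01 l0.
  apply: (le_trans h); rewrite -/c1 -/c2 -/ev /bound.
  have h2 : ev (X y * M + b * (X y ^+ 2 - s2)) <=
      16 * (ev (X y) * ev M + ev b * ev (X y ^+ 2 - s2)).
    by rewrite /ev -!evenpowM; apply: evenpowD; lra.
  have := ler_wpM2l c20 h2; lra.
have -> : (\int[P]_y (bound y)%:E = (\int[P]_y bound y)%:E)%E.
  by rewrite /Rintegral fineK //; exact: (integrable_fin_num measurableT j5).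
rewrite lee_fin /bound Rintegral_lin // Rintegral_lin // Rintegral_lin //.
rewrite Rintegral_lin // Rintegral_lin // X_mean X2_mean !Rintegral_cst //.
have -> : fine (P setT) = 1 by rewrite probability_setT.
have a4 := Rintegral_le i4 X_moment; have a5 := Rintegral_le i5 Z_moment.
have K0 : 0 <= K 
  by apply: le_trans a4; apply: Rintegral_ge0 => y _; exact: evenpow_ge0.
have eM := evenpow_ge0 (1 + k) M; have eb := evenpow_ge0 (1 + k) b.
have c232 : c2 <= 32 * l `^ (- k) by rewrite /c2; lra.
have b4 := ler_wpM2l (mulr_ge0 (mulr_ge0 c20 (ler0n _ 16)) eM) a4.
have b5 := ler_wpM2l (mulr_ge0 (mulr_ge0 c20 (ler0n _ 16)) eb) a5.
have := ler_wpM2r (mulr_ge0 K0 (addr_ge0 eM eb)) c232.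
move: b4 b5; rewrite -/ev; lra.
Qed.

End ConditionalStep.

Section MomentInequality.
Context {R : realType} {disp : measure_display} {T : measurableType disp}.
Variable P : probability T R.
Variables (X : nat -> {RV P >-> R}) (k K c : R) (s2 : nat -> R).
Hypothesis indep : mutually_independent P
  (fun i => sigma_generated (fun _ : unit => X i)).
Hypothesis k01 : 0 < k <= 1.
Hypothesis X_int : forall u, P.-integrable setT (EFin \o X u).
Hypothesis X_mean : forall u, \int[P]_x X u x = 0.
Hypothesis X2_int : forall u, P.-integrable setT (EFin \o (fun x => X u x ^+ 2)).
Hypothesis X2_mean : forall u, \int[P]_x (X u x ^+ 2) = s2 u.
Hypothesis X_moment : forall u,
  (\int[P]_x (evenpow (1 + k) (X u x))%:E <= K%:E)%E.
Hypothesis Z_moment : forall u,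
  (\int[P]_x (evenpow (1 + k) (X u x ^+ 2 - s2 u))%:E <= K%:E)%E.

(* [c] is any bound on the constant of [conditional_step]. *)
Hypothesis c_large : 512 * K <= c.

Let past l := pastType X (fun u => u < l)%N.

Let K_ge0 : 0 <= K.
Proof.
rewrite -lee_fin; apply: le_trans (X_moment 0).
by apply: integral_ge0 => x _; rewrite lee_fin evenpow_ge0.
Qed.

Let c_ge0 : 0 <= c.
Proof. exact: le_trans (mulr_ge0 (ler0n _ _) K_ge0) c_large. Qed.

(** [conditional_step] integrated over the past. *)
Lemma decoupled_step u (s M : T -> R) (b l a mu : R) :
  measurable_fun [set: past u] (s : past u -> R) ->
  measurable_fun [set: past u] (M : past u -> R) ->
  0 < l -> l <= 1 ->
  (\int[P]_x (evenpow (1 + k) (s x))%:E <= a%:E)%E ->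
  (\int[P]_x (evenpow (1 + k) (M x))%:E <= mu%:E)%E ->
  (\int[P]_x (evenpow (1 + k) (s x + X u x * M x + b * (X u x ^+ 2 - s2 u)))%:E
   <= ((1 + 16 * l) * a +
       c * l `^ (- k) * (mu + evenpow (1 + k) b))%:E)%E.
Proof.
move=> ms mM l0 l1 sa Mmu.
pose F (z : past u * R) :=
  (evenpow (1 + k) (s z.1 + z.2 * M z.1 + b * (z.2 ^+ 2 - s2 u)))%:E.
have mF : measurable_fun setT F.
  apply/measurable_EFinP/measurable_evenpow.
  have m1 h : measurable_fun [set: past u] h ->
      measurable_fun [set: past u * R] (fun z => h z.1 : R).
    by move=> mh; exact: measurableT_comp mh measurable_fst.
  apply: measurable_funD; first apply: measurable_funD.
  - exact: m1.
  - by apply: measurable_funM; [exact: measurable_snd|exact: m1].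
  apply: measurable_funM => //; apply: measurable_funB => //.
  by apply: measurable_funX; exact: measurable_snd.
have -> : (\int[P]_x (evenpow (1 + k)
    (s x + X u x * M x + b * (X u x ^+ 2 - s2 u)))%:E =
    \int[P]_x \int[P]_y F ((x : past u), X u y))%E.
  apply: (integral_decoupling indep (F := F)) => //; first by rewrite ltnn.
  by move=> z; rewrite lee_fin evenpow_ge0.
have mid : measurable_fun [set: T] (id : T -> past u).
  exact: (@past_id_measurable).  
have msT : measurable_fun setT s := measurableT_comp ms mid.
have mMT : measurable_fun setT M := measurableT_comp mM mid.
pose cl := c * l `^ (- k).
have cl0 : 0 <= cl by rewrite mulr_ge0 // powR_ge0.
have l16 : 0 <= 1 + 16 * l by rewrite addr_ge0 // mulr_ge0 // ltW.
pose g1 x := ((1 + 16 * l)%:E * (evenpow (1 + k) (s x))%:E)%E.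
pose g2 x := (cl%:E * (evenpow (1 + k) (M x) + evenpow (1 + k) b)%:E)%E.
have mes : measurable_fun setT (fun x => (evenpow (1 + k) (s x))%:E).
  exact/measurable_EFinP/measurable_evenpow.
have meM : measurable_fun setT (fun x => (evenpow (1 + k) (M x))%:E).
  exact/measurable_EFinP/measurable_evenpow.
have meMb : measurable_fun setT
    (fun x => (evenpow (1 + k) (M x) + evenpow (1 + k) b)%:E).
  apply/measurable_EFinP; apply: measurable_funD => //.
  exact: measurable_evenpow.
have mg1 : measurable_fun setT g1 by exact: measurable_funeM.
have mg2 : measurable_fun setT g2 by exact: measurable_funeM.
apply: (@le_trans _ _ (\int[P]_x (g1 x + g2 x))%E).
  apply: ge0_le_integral => //.
  - by move=> x _; apply: integral_ge0 => y _; rewrite lee_fin evenpow_ge0.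
  - have h := measurable_fun_fubini_tonelli_F (m2 := distribution P (X u)) F mF
      (fun z => evenpow_ge0 _ _ : (0 <= F z)%E).
    have {h} := measurableT_comp h mid.
    apply: eq_measurable_fun => x _ /=; rewrite /fubini_F.
    rewrite ge0_integral_distribution //=; last first.
      by move=> y; rewrite lee_fin evenpow_ge0.
    exact: measurableT_comp mF (pair1_measurable _).
  - exact: emeasurable_funD.
  move=> x _; rewrite /g1 /g2 /cl -!EFinM -EFinD.
  apply: le_trans (_ : _ <= _)%E; first exact: (conditional_step k01 (X_int u) (X_mean u) (X2_int u) (X2_mean u)
    (X_moment u) (Z_moment u) (s x) (M x) b l0 l1).
  rewrite lee_fin lerD2l ler_wpM2r ?addr_ge0 ?evenpow_ge0 //.
  by rewrite ler_wpM2r ?powR_ge0.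
rewrite ge0_integralD //; last 2 first.
- by move=> x _; rewrite mule_ge0 // lee_fin ?evenpow_ge0.
- by move=> x _; rewrite mule_ge0 // lee_fin ?addr_ge0 ?evenpow_ge0.
rewrite !ge0_integralZl //; try by
  move=> x _; rewrite lee_fin ?addr_ge0 ?evenpow_ge0.
have -> : (\int[P]_x (evenpow (1 + k) (M x) + evenpow (1 + k) b)%:E =
    \int[P]_x (evenpow (1 + k) (M x))%:E + (evenpow (1 + k) b)%:E)%E.
  under eq_integral do rewrite EFinD.
  rewrite ge0_integralD //.
  - congr (_ + _)%E; apply: (etrans (integral_cst P measurableT _)).
    by rewrite -[RHS]mule1; congr (_ * _)%E; exact: probability_setT.
  - by move=> x _; rewrite lee_fin evenpow_ge0.
  - by move=> x _; rewrite lee_fin evenpow_ge0.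
rewrite [leRHS]EFinD !(EFinM _ _) -/cl.
apply: leeD; first by rewrite lee_wpmul2l // lee_fin.
by rewrite lee_wpmul2l ?lee_fin // EFinD leeD2r.
Qed.

Let D := 2 * c * 32 `^ k.

Let D_ge0 : 0 <= D.
Proof. by rewrite !mulr_ge0 // powR_ge0. Qed.

(** Increments with predictable factors [M u], their squared norms being controlled
by [g u]. The number [G] bounds the whole sum of the [g u]; with [l] equal to
[g u / (32 G)] in [decoupled_step], the factor [1 + 16 l = 1 + g u / (2 G)] turns a
bound linear in the partial sums of [g] into a bound of the same form. *)
Lemma martingale_moment (M : nat -> T -> R) (b g : nat -> R) (c0 G : R) (L : nat) :
  (forall u v, (u <= v)%N -> measurable_fun [set: past v] (M u : past v -> R)) ->
  0 <= c0 -> (forall u, 0 <= g u) ->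
  (forall u, \int[P]_x (evenpow (1 + k) (M u x))%:E
     <= (c0 * g u `^ (1 + k))%:E)%E ->
  (forall u, evenpow (1 + k) (b u) <= c0 * g u `^ (1 + k)) ->
  (forall u, g u = 0 -> (forall x, M u x = 0) /\ b u = 0) ->
  0 < G -> \sum_(u < L) g u <= G ->
  (\int[P]_x (evenpow (1 + k)
     (\sum_(u < L) (X u x * M u x + b u * (X u x ^+ 2 - s2 u))))%:E <=
   (2 * D * c0 * G `^ k * \sum_(u < L) g u)%:E)%E.
Proof.
move=> mM c00 g0 Mg bg gz G0; have /andP[k0 k1] := k01.
elim: L => [|L IH].
  move=> _; under eq_integral do rewrite big_ord0.
  rewrite big_ord0 mulr0 evenpow0; last by rewrite addr_gt0.
  by rewrite integral0.
rewrite !big_ord_recr /= => GL.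
have GL' : \sum_(u < L) g u <= G by have := g0 L; lra.
have {}IH := IH GL'.
under eq_integral do rewrite big_ord_recr /=.
have [gL|gL] := eqVneq (g L) 0.
  have [M0 b0] := gz _ gL; rewrite gL addr0.
  by under eq_integral do rewrite M0 b0 mulr0 mul0r !addr0.
have gL0 : 0 < g L by rewrite lt_neqAle eq_sym gL g0.
have gG : g L <= G.
  by apply: le_trans GL; rewrite lerDr; apply: sumr_ge0.
pose l := g L / (32 * G).
have G32 : 0 < 32 * G by rewrite mulr_gt0.
have l0 : 0 < l by rewrite divr_gt0.
have l1 : l <= 1 by rewrite ler_pdivrMr // mul1r; lra.
under eq_integral do rewrite addrA.
apply: (le_trans (@decoupled_step L _ (M L) (b L) l _ _ _ (mM _ _ (leqnn _)) l0 l1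
  IH (Mg L))).
  apply: (@measurable_sum _ (past L) _ _ _ _ (fun (u : 'I_L) (x : past L) =>
    X u x * M u x + b u * (X u x ^+ 2 - s2 u))) => u.
  have mXu : measurable_fun [set: past L] (X u : past L -> R).
    exact: measurable_past.
  apply: measurable_funD.
    by apply: measurable_funM => //; apply: mM; exact: ltnW.
  apply: measurable_funM => //; apply: measurable_funB => //.
  exact: measurable_funX.
rewrite lee_fin; set S := \sum_(u < L) g u in GL GL' *.
have S0 : 0 <= S by apply: sumr_ge0.
have key : l `^ (- k) * g L `^ (1 + k) = 32 `^ k * G `^ k * g L.
  have e : g L = l * (32 * G) by rewrite /l divfK // gt_eqF.
  rewrite powRD ?gt_eqF ?addr_gt0 // powRr1 // {2}e.
  rewrite (powRM _ (ltW l0) (ltW G32)) (powRM _ (ler0n _ 32) (ltW G0)) powRN.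
  by rewrite mulrCA mulKf ?gt_eqF ?powR_gt0 // mulrC.
have Gk := powR_ge0 G k.
have h1 : c * l `^ (- k) * (c0 * g L `^ (1 + k) + evenpow (1 + k) (b L)) <=
    D * c0 * G `^ k * g L.
  have -> : D * c0 * G `^ k * g L =
      c * l `^ (- k) * (2 * (c0 * g L `^ (1 + k))).
    have -> : c * l `^ (- k) * (2 * (c0 * g L `^ (1 + k))) =
      2 * c * c0 * (l `^ (- k) * g L `^ (1 + k)) by ring.
    by rewrite key /D; ring.
  rewrite ler_wpM2l ?mulr_ge0 ?powR_ge0 // mulr2n mulrDl mul1r lerD2l.
  exact: bg.
have h2 : 16 * l * (2 * D * c0 * G `^ k * S) <= D * c0 * G `^ k * g L.
  have -> : 16 * l * (2 * D * c0 * G `^ k * S) = D * c0 * G `^ k * (32 * l * S).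
    by ring.
  rewrite ler_wpM2l ?mulr_ge0 //.
  have -> : 32 * l * S = g L * (S / G) by rewrite /l; field; rewrite gt_eqF.
  by rewrite ler_piMr // ler_pdivrMr // mul1r.
lra.
Qed.

Lemma linear_moment (a : nat -> R) (L : nat) :
  (\int[P]_x (evenpow (1 + k) (\sum_(u < L) a u * X u x))%:E <=
   (2 * D * (\sum_(u < L) a u ^+ 2) `^ (1 + k))%:E)%E.
Proof.
have /andP[k0 k1] := k01; set G := \sum_(u < L) _.
have G0 : 0 <= G by apply: sumr_ge0 => u _; exact: sqr_ge0.
have q0 : 0 < 1 + k by rewrite addr_gt0.
have [Gz|Gnz] := eqVneq G 0.
  have az (u : 'I_L) : a u = 0.
    apply/eqP; rewrite -sqrf_eq0; apply/eqP.
    by apply: (psumr_eq0P _ Gz) => // i _; exact: sqr_ge0.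
  under eq_integral do under eq_bigr do rewrite az mul0r.
  under eq_integral do rewrite big1_eq evenpow0 //.
  by rewrite integral0 Gz powR0 ?gt_eqF // mulr0.
have Gp : 0 < G by rewrite lt_neqAle eq_sym Gnz.
have := @martingale_moment (fun u _ => a u) (fun=> 0) (fun u => a u ^+ 2) 1 G L.
under eq_integral do under eq_bigr do rewrite mul0r addr0 mulrC.
have -> : 2 * D * 1 * G `^ k * \sum_(u < L) a u ^+ 2 = 2 * D * G `^ (1 + k).
  by rewrite mulr1 -mulrA powRD ?gt_eqF // powRr1 // [G `^ k * _]mulrC.
apply => //.
- by move=> u; exact: sqr_ge0.
- move=> u; rewrite mul1r.
  apply: (@le_trans _ _ (\int[P]_x (cst (evenpow (1 + k) (a u))%:E x))%E) => //.
  rewrite integral_cst // -[leRHS]mule1; apply: lee_wpmul2l.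
    by rewrite lee_fin evenpow_ge0.
  exact: probability_le1.
- by move=> u; rewrite evenpow0 // mul1r powR_ge0.
- by move=> u /eqP; rewrite sqrf_eq0 => /eqP.
Qed.

(** The index pairs are grouped by their larger entry, which exhibits the
centred quadratic form as a sum of martingale differences. *)
Lemma quadratic_form_increments (b : nat -> nat -> R) (e s : nat -> R) (L : nat) :
  \sum_(u < L) \sum_(v < L) b u v * e u * e v - \sum_(u < L) b u u * s u =
  \sum_(l < L) (e l * \sum_(u < l) (b u l + b l u) * e u
                + b l l * (e l ^+ 2 - s l)).
Proof.
elim: L => [|L IH]; first by rewrite !big_ord0 subr0.
rewrite [RHS]big_ord_recr /= -IH [in LHS]big_ord_recr /=.
rewrite [X in _ - X]big_ord_recr /= [X in _ + X - _]big_ord_recr /=.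
under eq_bigr do rewrite big_ord_recr /=.
rewrite big_split /= mulr_sumr.
have -> : \sum_(u < L) e L * ((b u L + b L u) * e u) =
    \sum_(u < L) b u L * e u * e L + \sum_(u < L) b L u * e L * e u.
  by rewrite -big_split /=; apply: eq_bigr => u _; ring.
by ring.
Qed.

(** [martingale_moment] applies twice: the predictable factor of the [l]-th
increment is a linear form in the past, bounded by [linear_moment]. *)
Lemma quadratic_moment (b : nat -> nat -> R) (L : nat) (G : R) :
  0 < G ->
  \sum_(l < L) (b l l ^+ 2 + \sum_(u < l) (b u l + b l u) ^+ 2) <= G ->
  (\int[P]_x (evenpow (1 + k)
     (\sum_(u < L) \sum_(v < L) b u v * X u x * X v x
      - \sum_(u < L) b u u * s2 u))%:E <=
   (2 * D * (2 * D + 1) * G `^ (1 + k))%:E)%E.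
Proof.
have /andP[k0 k1] := k01; move=> G0 bG.
have q0 : 0 < 1 + k by rewrite addr_gt0.
under eq_integral => x _ do
  rewrite (quadratic_form_increments b (fun u => X u x) s2).
pose g l := b l l ^+ 2 + \sum_(u < l) (b u l + b l u) ^+ 2.
have sq0 l : 0 <= \sum_(u < l) (b u l + b l u) ^+ 2.
  by apply: sumr_ge0 => u _; exact: sqr_ge0.
have powle (x y : R) : 0 <= x -> x <= y -> x `^ (1 + k) <= y `^ (1 + k).
  move=> x0 xy; apply: (ge0_ler_powR (ltW q0) _ _ xy); rewrite nnegrE //.
  exact: le_trans xy.
have D20 : 0 <= 2 * D + 1 by rewrite addr_ge0 // mulr_ge0.
have D21 : 1 <= 2 * D + 1 by rewrite lerDr mulr_ge0.
apply: (le_trans (@martingale_moment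
  (fun l x => \sum_(u < l) (b u l + b l u) * X u x) (fun l => b l l) g
  (2 * D + 1) G L _ _ _ _ _ _ _ _)) => //.
- move=> u v uv.
  apply: (@measurable_sum _ (past v) _ _ _ _ (fun (w : 'I_u) (x : past v) =>
    (b w u + b u w) * X w x)) => w.
  apply: measurable_funM => //.
  by apply: measurable_past; exact: leq_trans (ltn_ord w) uv.
- by move=> u; rewrite addr_ge0 ?sqr_ge0.
- move=> u; apply: (le_trans (linear_moment (fun w => b w u + b u w) u)).
  rewrite lee_fin; apply: ler_pM; rewrite ?powR_ge0 ?mulr_ge0 //.
    by rewrite lerDl.
  by apply: powle; rewrite // lerDr sqr_ge0.
- move=> u; apply: (@le_trans _ _ (1 * g u `^ (1 + k))).
    by rewrite mul1r; apply: powle; rewrite ?sqr_ge0 // lerDl.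
  by rewrite ler_wpM2r ?powR_ge0.
- move=> u /eqP; rewrite paddr_eq0 ?sqr_ge0 // sqrf_eq0 => /andP[/eqP b0 /eqP h].
  split=> // x; rewrite big1 // => w _.
  suff /eqP : (b w u + b u w) ^+ 2 = 0 by rewrite sqrf_eq0 => /eqP ->; rewrite mul0r.
  by apply: (psumr_eq0P _ h) => // i _; exact: sqr_ge0.
rewrite lee_fin -mulrA ler_wpM2l ?mulr_ge0 //.
by rewrite powRD ?gt_eqF // (powRr1 (ltW G0)) mulrC ler_wpM2r ?powR_ge0.
Qed.

End MomentInequality.

(** * Moments of one innovation *)

Section MomentConstants.
Context {R : realType} {disp : measure_display} {T : measurableType disp}.
Variable P : probability T R.
(* All the moments used come from one bound of order [4 (1 + k)]. *)
Variables (X : {RV P >-> R}) (k m : R).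
Hypothesis k01 : 0 < k <= 1.
Hypothesis moment : (\int[P]_x (evenpow (1 + k) (X x ^+ 2))%:E <= m%:E)%E.

Let mX : measurable_fun setT (X : T -> R).
Proof. exact: measurable_funP. Qed.

Let mX2 : measurable_fun setT (fun x => X x ^+ 2).
Proof. exact: measurable_funX. Qed.

Let le_1D_sqr (t : R) : t <= 1 + t ^+ 2.
Proof. by have := sqr_ge0 (t - 2^-1); have := sqr_ge0 t; nra. Qed.

Let sqr_le (t : R) : t ^+ 2 <= 1 + evenpow (1 + k) (t ^+ 2).
Proof.
have [t1|t1] := leP (t ^+ 2) 1; first by have := evenpow_ge0 (1 + k) (t ^+ 2); lra.
apply: (@le_trans _ _ ((t ^+ 2) ^+ 2)).
  by rewrite expr2 ler_peMr ?sqr_ge0 // ltW.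
apply: (@le_trans _ _ (evenpow (1 + k) (t ^+ 2))); last by rewrite lerDr.
apply: le1r_powR; last by have /andP[/ltW k0 _] := k01; rewrite lerDl.
by rewrite exprn_ege1 // ltW.
Qed.

Let moment1 : (\int[P]_x (1 + evenpow (1 + k) (X x ^+ 2))%:E <= (1 + m)%:E)%E.
Proof.
under eq_integral do rewrite EFinD.
rewrite ge0_integralD //; first last.
- exact/measurable_EFinP/measurable_evenpow.
- by move=> x _; rewrite lee_fin evenpow_ge0.
rewrite EFinD; apply: leeD moment.
rewrite (integral_cst P measurableT) -[leRHS]mule1; apply: lee_wpmul2l => //.
exact: probability_le1.
Qed.

Lemma moment_bound_ge0 : 0 <= m.
Proof.
rewrite -lee_fin; apply: le_trans moment.
by apply: integral_ge0 => x _; rewrite lee_fin evenpow_ge0.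
Qed.

Lemma square_moment_le : (\int[P]_x (X x ^+ 2)%:E <= (1 + m)%:E)%E.
Proof.
apply: le_trans moment1; apply: ge0_le_integral => //.
- by move=> x _; rewrite lee_fin sqr_ge0.
- exact/measurable_EFinP.
- by apply/measurable_EFinP/measurable_funD => //; exact: measurable_evenpow.
- by move=> x _; rewrite lee_fin.
Qed.

Lemma square_integrable : P.-integrable setT (EFin \o (fun x => X x ^+ 2)).
Proof.
by apply: integrable_le_bound square_moment_le => // x; exact: sqr_ge0.
Qed.

Lemma first_integrable : P.-integrable setT (EFin \o X).
Proof.
have h := integrable_lin 1 (@finite_measure_integrable_cst _ _ _ P _ 1 measurableT)
  square_integrable.
apply: (le_integrable measurableT _ _ h); first exact/measurable_EFinP.
move=> x _; rewrite /= lee_fin mul1r [leRHS]ger0_norm ?addr_ge0 ?sqr_ge0 //.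
by rewrite (le_trans (le_1D_sqr _)) // real_normK // num_real.
Qed.

Lemma variance_bounds : 0 <= \int[P]_x (X x ^+ 2) <= 1 + m.
Proof.
apply/andP; split; first by apply: Rintegral_ge0 => x _; exact: sqr_ge0.
rewrite -lee_fin /Rintegral fineK; first exact: square_moment_le.
exact: (integrable_fin_num measurableT square_integrable).
Qed.

Let K := 16 * (m + (1 + m) ^+ 4).

Lemma half_moment_le : (\int[P]_x (evenpow (1 + k) (X x))%:E <= K%:E)%E.
Proof.
have m0 := moment_bound_ge0.
apply: (@le_trans _ _ (1 + m)%:E); last first.
  rewrite lee_fin /K; have : 1 + m <= (1 + m) ^+ 4 by rewrite ler_eXnr // lerDl.
  lra.
apply: le_trans moment1; apply: ge0_le_integral => //.
- by move=> x _; rewrite lee_fin evenpow_ge0.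
- exact/measurable_EFinP/measurable_evenpow.
- by apply/measurable_EFinP/measurable_funD => //; exact: measurable_evenpow.
move=> x _; rewrite lee_fin.
have -> : evenpow (1 + k) (X x ^+ 2) = evenpow (1 + k) (X x) ^+ 2.
  by rewrite [X x ^+ 2]expr2 evenpowM -expr2.
exact: le_1D_sqr.
Qed.

Lemma centred_square_moment_le :
  (\int[P]_x (evenpow (1 + k) (X x ^+ 2 - \int[P]_y (X y ^+ 2)))%:E <= K%:E)%E.
Proof.
have m0 := moment_bound_ge0; have /andP[k0 k1] := k01.
have /andP[v0 v1] := variance_bounds; set s2 := \int[P]_y _ in v0 v1 *.
have es : evenpow (1 + k) (- s2) <= (1 + m) ^+ 4.
  rewrite /evenpow sqrrN; apply: (@le_trans _ _ (((1 + m) ^+ 2) `^ 2)).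
    apply: (@le_trans _ _ (((1 + m) ^+ 2) `^ (1 + k))).
      apply: ge0_ler_powR; rewrite ?nnegrE ?sqr_ge0 ?lerXn2r ?nnegrE //; lra.
    by apply: ler_powR; [rewrite exprn_ege1 // lerDl|rewrite lerD2l].
  by rewrite powR_mulrn ?sqr_ge0 // -exprM.
apply: (@le_trans _ _
  (\int[P]_x (16%:E * (evenpow (1 + k) (X x ^+ 2) + (1 + m) ^+ 4)%:E)))%E.
  apply: ge0_le_integral => //.
  - by move=> x _; rewrite lee_fin evenpow_ge0.
  - by apply/measurable_EFinP/measurable_evenpow/measurable_funB.
  - apply: measurable_funeM; apply/measurable_EFinP/measurable_funD => //.
    exact: measurable_evenpow.
  move=> x _; rewrite -EFinM lee_fin.
  apply: (le_trans (evenpowD (X x ^+ 2) (- s2) _)); first by lra.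
  by rewrite ler_wpM2l // lerD2l.
have m4 : 0 <= (1 + m) ^+ 4 by rewrite exprn_ge0 // addr_ge0.
rewrite ge0_integralZl //; last 2 first.
- by apply/measurable_EFinP/measurable_funD => //; exact: measurable_evenpow.
- by move=> x _; rewrite lee_fin addr_ge0 ?evenpow_ge0.
rewrite /K EFinM lee_wpmul2l //.
under eq_integral do rewrite EFinD.
rewrite ge0_integralD //; last 2 first.
- by move=> x _; rewrite lee_fin evenpow_ge0.
- exact/measurable_EFinP/measurable_evenpow.
rewrite EFinD; apply: leeD => //.
rewrite (integral_cst P measurableT) -[leRHS]mule1; apply: lee_wpmul2l => //.
exact: probability_le1.
Qed.

End MomentConstants.

(** * Coefficients of linear processes *)

Section Decay.
Context {R : realType}.
Implicit Types (a s t : R) (i j n N L : nat).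

(** The index is truncated at 1, so that [decay a 0 = 1]. *)
Definition decay a j : R := (maxn j 1)%:R `^ (- a).

Lemma decay_ge0 a j : 0 <= decay a j.
Proof. exact: powR_ge0. Qed.

Lemma maxn1_gt0 j : 0 < (maxn j 1)%:R :> R.
Proof. by rewrite ltr0n leq_max orbT. Qed.

Lemma decayD a s j : decay (a + s) j = decay a j * decay s j.
Proof. by rewrite /decay opprD powRD // (gt_eqF (maxn1_gt0 j)) implybT. Qed.

Lemma decay_le a i j : 0 <= a -> (i <= j)%N -> decay a j <= decay a i.
Proof.
move=> a0 ij; rewrite /decay !powRN lef_pV2 ?posrE ?powR_gt0 ?maxn1_gt0 //.
apply: ge0_ler_powR; rewrite ?nnegrE // ler_nat geq_max !leq_max ij leqnn.
by rewrite orbT.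
Qed.

(** The tangent inequality for [u `^ (- s)] at [u = 1], applied to
[u = (x - 1) / x]; summed over integers it telescopes. *)
Lemma powR_telescope s (x : R) : 0 < s -> 1 < x ->
  s * x `^ (- (1 + s)) <= (x - 1) `^ (- s) - x `^ (- s).
Proof.
move=> s0 x1; have x0 : 0 < x by exact: lt_trans x1.
have y0 : 0 < x - 1 by rewrite subr_gt0.
pose u := 1 + - x^-1.
have u0 : 0 < u by rewrite subr_gt0 invf_lt1.
have xu : x - 1 = x * u by rewrite /u mulrDr mulrN mulr1 divff // gt_eqF.
have uE : u `^ (- s) >= 1 + s / x.
  rewrite /powR (gt_eqF u0); apply: (le_trans _ (expR_ge1Dx _)); rewrite lerD2l.
  rewrite mulNr -mulrN ler_pM2l // lerNr.
  by apply: le_ln1Dx; rewrite ltrN2 invf_lt1.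
rewrite xu (powRM _ (ltW x0) (ltW u0)).
rewrite opprD powRD ?(gt_eqF x0) ?implybT // (powRN _ 1) (powRr1 (ltW x0)).
have := ler_wpM2l (powR_ge0 x (- s)) uE.
by rewrite mulrDr mulr1 [s / x]mulrC => h; rewrite mulrC lerBrDl; move: h; lra.
Qed.

Lemma sum_decay s N : 0 < s -> \sum_(j < N) decay (1 + s) j <= 2 + s^-1.
Proof.
move=> s0.
suff h M : \sum_(j < M.+2) decay (1 + s) j <= 2 + s^-1 * (1 - M.+1%:R `^ (- s)).
  apply: (@le_trans _ _ (\sum_(j < N.+2) decay (1 + s) j)).
    by rewrite !big_ord_recr /= -addrA lerDl addr_ge0 ?decay_ge0.
  apply: (le_trans (h N)); rewrite lerD2l.
  by apply: ler_piMr; rewrite ?invr_ge0 ?(ltW s0) // gerBl powR_ge0.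
elim: M => [|M IH].
  by rewrite !big_ord_recr big_ord0 /= /decay /= maxnn !powR1 subrr mulr0; lra.
rewrite big_ord_recr /=; apply: (le_trans (lerD IH (lexx _))).
rewrite -addrA lerD2l -lerBrDl -mulrBr -ler_pdivrMl ?invr_gt0 // invrK.
have /(powR_telescope s0) : 1 < M.+2%:R :> R by rewrite ltr1n.
have -> : M.+2%:R - 1 = M.+1%:R :> R by rewrite -natr1 addrK.
by rewrite /decay (maxn_idPl _) //; lra.
Qed.

Lemma sum_shift_le (f : nat -> R) i L : (forall j, 0 <= f j) ->
  \sum_(u < L) (if (i <= u)%N then f (u - i)%N else 0) <= \sum_(j < L) f j.
Proof.
move=> f0; rewrite -(big_mkord xpredT (fun u => if (i <= u)%N then f (u - i)%N else 0)).
rewrite -(big_mkord xpredT f) -big_mkcond /=.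
have [iL|Li] := leqP i L; last first.
  rewrite big_nat_cond big1 ?sumr_ge0 // => u /andP[/andP[_ uL] iu].
  by have := leq_ltn_trans iu (ltn_trans uL Li); rewrite ltnn.
rewrite (big_cat_nat (leq0n i) iL) //= big_nat_cond big1 ?add0r; last first.
  by move=> u /andP[/andP[_ ui]]; rewrite leqNgt ui.
rewrite -{1}(add0n i) big_addn; under eq_bigr do rewrite addnK.
under eq_bigl do rewrite leq_addl.
rewrite [leRHS](big_cat_nat (leq0n _) (leq_subr i L)) //= lerDl.
by apply: sumr_ge0.
Qed.

Variable theta : R.
Hypothesis theta_gt0 : 0 < theta.

(** The dominating coefficient of the [u]-th innovation, counted backwards
from time [n], in the observation at time [n - i]. *)
Definition envelope u i : R :=
  if (i <= u)%N then decay (3 / 4 + theta / 2) (u - i) else 0.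

Lemma envelope_ge0 u i : 0 <= envelope u i.
Proof. by rewrite /envelope; case: ifP => // _; exact: decay_ge0. Qed.

Definition gap i j := (i - j + (j - i))%N.

Let C1 := 2 + (3 / 4 * theta)^-1.
Let C2 := 2 + (theta / 2)^-1.

(** Splitting the exponent as [(1/2 + theta/4) + (1/4 + theta/4)], the first
part is spent on the gap, and the second makes the sum converge. *)
Lemma sum_envelope_prod L i j :
  \sum_(u < L) envelope u i * envelope u j <= C1 * decay (1 / 2 + theta / 4) (gap i j).
Proof.
wlog ij : i j / (i <= j)%N => [h|].
  have [/h //|/ltnW /h] := leqP i j.
  rewrite /gap addnC; under eq_bigr do rewrite mulrC.
  by [].
have -> : gap i j = (j - i)%N by rewrite /gap; move/eqP: ij => ->.
apply: (@le_trans _ _ (decay (1 / 2 + theta / 4) (j - i) *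
   \sum_(u < L) (if (j <= u)%N then decay (1 + 3 / 4 * theta) (u - j) else 0))).
  rewrite mulr_sumr; apply: ler_sum => u _; rewrite /envelope.
  have [ju|_] := leqP j u; last by rewrite !mulr0.
  rewrite (leq_trans ij ju).
  have -> : 1 + 3 / 4 * theta = (1 / 4 + theta / 4) + (3 / 4 + theta / 2) by field.
  rewrite (decayD (1 / 4 + theta / 4)) mulrA ler_wpM2r ?decay_ge0 //.
  have -> : 3 / 4 + theta / 2 = (1 / 2 + theta / 4) + (1 / 4 + theta / 4) by field.
  rewrite (decayD (1 / 2 + theta / 4)); apply: ler_pM; rewrite ?decay_ge0 //;
    apply: decay_le.
  - by rewrite addr_ge0 // divr_ge0 // ltW.
  - by rewrite leq_sub2r.
  - by rewrite addr_ge0 // divr_ge0 // ltW.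
  - by rewrite leq_sub2l.
rewrite mulrC ler_wpM2r ?decay_ge0 //.
apply: (le_trans (@sum_shift_le (decay (1 + 3 / 4 * theta)) j L _)).
  by move=> u; exact: decay_ge0.
by apply: sum_decay; rewrite mulr_gt0 // divr_gt0.
Qed.

(** Each gap is taken at most once on either side of [i]. *)
Lemma sum_gap n i (f : nat -> R) : (i < n)%N -> (forall j, 0 <= f j) ->
  \sum_(j < n) f (gap i j) <= 2 * \sum_(j < n) f j.
Proof.
move=> i_lt f0; rewrite mulr_natl mulr2n.
apply: (@le_trans _ _ (\sum_(j < n) (if (i <= j)%N then f (j - i)%N else 0)
   + \sum_(j < n) (if (n.-1 - i <= j)%N then f (j - (n.-1 - i))%N else 0))).
  rewrite [X in _ + X](reindex_inj rev_ord_inj) -big_split /=.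
  apply: ler_sum => j _; rewrite /gap.
  have [ij|ji] := leqP i j.
    move/eqP: (ij) => ->; rewrite add0n lerDl; case: ifP => // _; exact: f0.
  have -> : (j - i = 0)%N by apply/eqP; rewrite subn_eq0 ltnW.
  have jn := ltn_ord j.
  have -> : (n.-1 - i <= n - j.+1)%N by lia.
  rewrite add0r addn0 (_ : (n - j.+1 - (n.-1 - i) = i - j)%N) //.
  by lia.
by apply: lerD; exact: sum_shift_le.
Qed.

(** Up to a constant, these entries dominate the coefficients of any quadratic form
with bounded weights in the observations at times 1 to [n]. *)
Definition envelope_form n u v : R := \sum_(i < n) envelope u i * envelope v i.

Lemma envelope_form_trace n L :
  \sum_(u < L) envelope_form n u u <= C1 * n%:R.
Proof.
rewrite /envelope_form exchange_big /=.
have -> : C1 * n%:R = \sum_(i < n) C1 by rewrite sumr_const card_ord mulr_natr.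
apply: ler_sum => i _.
apply: (le_trans (sum_envelope_prod L i i)).
by rewrite /gap subnn /decay /= powR1 mulr1.
Qed.

(** Exchanging the sums gives [sum_(i, j) r(i, j)^2] with [r(i, j)] at most of order
[|i - j|^(-1/2 - theta/4)], by [sum_envelope_prod]; the squares are summable in
[j]. *)
Lemma envelope_form_sqr n L :
  \sum_(u < L) \sum_(v < L) envelope_form n u v ^+ 2 <= 2 * C1 ^+ 2 * C2 * n%:R.
Proof.
have C10 : 0 <= C1 by rewrite addr_ge0 // invr_ge0 mulr_ge0 // ltW.
have -> : \sum_(u < L) \sum_(v < L) envelope_form n u v ^+ 2 =
    \sum_(i < n) \sum_(j < n) (\sum_(u < L) envelope u i * envelope u j) ^+ 2.
  transitivity (\sum_(u < L) \sum_(v < L) \sum_(i < n) \sum_(j < n)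
     (envelope u i * envelope v i * (envelope u j * envelope v j))).
    apply: eq_bigr => u _; apply: eq_bigr => v _.
    by rewrite expr2 /envelope_form big_distrlr.
  transitivity (\sum_(i < n) \sum_(j < n) \sum_(u < L) \sum_(v < L)
     (envelope u i * envelope v i * (envelope u j * envelope v j))).
    under eq_bigr do rewrite exchange_big.
    rewrite exchange_big; apply: eq_bigr => i _.
    under eq_bigr do rewrite exchange_big.
    by rewrite exchange_big.
  apply: eq_bigr => i _; apply: eq_bigr => j _.
  rewrite expr2 big_distrlr /=; apply: eq_bigr => u _; apply: eq_bigr => v _.
  by ring.
have -> : 2 * C1 ^+ 2 * C2 * n%:R = \sum_(i < n) C1 ^+ 2 * (2 * C2).
  by rewrite sumr_const card_ord mulr_natr; congr (_ *+ _); ring.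
apply: ler_sum => i _.
apply: (@le_trans _ _ (\sum_(j < n) C1 ^+ 2 * decay (1 + theta / 2) (gap i j))).
  apply: ler_sum => j _.
  have -> : 1 + theta / 2 = (1 / 2 + theta / 4) + (1 / 2 + theta / 4) by field.
  rewrite (decayD (1 / 2 + theta / 4)) -expr2 -exprMn lerXn2r ?nnegrE ?mulr_ge0 ?decay_ge0 //.
    by apply: sumr_ge0 => u _; rewrite mulr_ge0 ?envelope_ge0.
  exact: sum_envelope_prod.
rewrite -mulr_sumr ler_wpM2l ?sqr_ge0 //.
apply: (le_trans (sum_gap (ltn_ord i) (decay_ge0 _))).
by rewrite ler_wpM2l // sum_decay // divr_gt0.
Qed.

End Decay.

(** * Tail bounds *)

Section QuadraticTail.
Context {R : realType} {disp : measure_display} {T : measurableType disp}.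
Variable P : probability T R.

Lemma measurable_superlevel d (U : measurableType d) (f : U -> R) (a : R) :
  measurable_fun setT f -> measurable [set x | a < f x].
Proof.
move=> mf; have -> : [set x | a < f x] = setT `&` f @^-1` `]a, +oo[.
  by rewrite setTI; apply/seteqP; split => x /=; rewrite in_itv /= andbT.
exact: mf.
Qed.

Lemma markov_real (f : T -> R) (a b : R) : measurable_fun setT f ->
  (forall x, 0 <= f x) -> 0 < a -> (\int[P]_x (f x)%:E <= b%:E)%E ->
  (P [set x | (a <= f x)%R] <= (b / a)%:E)%E.
Proof.
move=> mf f0 a0 fb.
have mfE : measurable_fun setT (EFin \o f) by exact/measurable_EFinP.
have := le_integral_abse P measurableT mfE a0.
have -> : [set: T] `&` [set x | (a%:E <= `|(EFin \o f) x|)%E] = [set x | a <= f x].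
  by rewrite setTI; apply/seteqP; split => x /=; rewrite lee_fin ger0_norm.
have -> : (\int[P]_x `|(EFin \o f) x| = \int[P]_x (f x)%:E)%E.
  by apply: eq_integral => x _ /=; rewrite ger0_norm.
move=> /le_trans /(_ fb) h.
by rewrite mulrC EFinM lee_pdivlMl.
Qed.

Let sqr_sum2_le (x y z C : R) : `|x| <= C * z -> `|y| <= C * z ->
  (x + y) ^+ 2 <= 4 * C ^+ 2 * z ^+ 2.
Proof.
move=> xz yz; have -> : 4 * C ^+ 2 * z ^+ 2 = (2 * (C * z)) ^+ 2 by ring.
rewrite -(real_normK (num_real (x + y))) lerXn2r ?nnegrE //.
  by rewrite mulr_ge0 // (le_trans _ xz).
by rewrite (le_trans (ler_normD _ _)) // mulr_natl mulr2n lerD.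
Qed.

Lemma dominated_coefficients (theta C0 : R) (b : nat -> nat -> R) (n L : nat) :
  0 < theta ->
  (forall u v, `|b u v| <= C0 * envelope_form theta n u v) ->
  \sum_(l < L) (b l l ^+ 2 + \sum_(u < l) (b u l + b l u) ^+ 2) <=
  4 * C0 ^+ 2 *
    (2 * (2 + (3 / 4 * theta)^-1) ^+ 2 * (2 + (theta / 2)^-1) * n%:R).
Proof.
move=> th0 bC.
have bC' u v : `|b v u| <= C0 * envelope_form theta n u v.
  apply: le_trans (bC _ _) _; rewrite le_eqVlt; apply/orP; left; apply/eqP.
  by congr (_ * _); apply: eq_bigr => i _; rewrite mulrC.
apply: (@le_trans _ _ (4 * C0 ^+ 2 *
    \sum_(u < L) \sum_(v < L) envelope_form theta n u v ^+ 2)); last first.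
  apply: ler_wpM2l; first by rewrite mulr_ge0 ?sqr_ge0.
  exact: envelope_form_sqr.
rewrite exchange_big /= mulr_sumr; apply: ler_sum => l _.
rewrite mulr_sumr.
pose f u := 4 * C0 ^+ 2 * envelope_form theta n u l ^+ 2.
have f0 u : 0 <= f u.
  by apply: mulr_ge0; rewrite ?sqr_ge0 // mulr_ge0 ?sqr_ge0.
apply: (@le_trans _ _ (\sum_(u < l.+1) f u)).
  rewrite big_ord_recr /= [leLHS]addrC; apply: lerD.
    by apply: ler_sum => u _; exact: sqr_sum2_le.
  have -> : b l l ^+ 2 = (b l l + 0) ^+ 2 by rewrite addr0.
  by apply: sqr_sum2_le => //; rewrite normr0 (le_trans _ (bC l l)).
rewrite (big_ord_widen _ f (ltn_ord l)) big_mkcond /=; apply: ler_sum => u _.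
by case: ifP => // _; exact: f0.
Qed.

(** The mean of the form is at most [C0 (1 + m) C1 n]; one further unit in [a] makes
the centred form exceed [n], and the Markov inequality of order [2 (1 + k)]
compares [n^(1 + k)] with [n^(2 (1 + k))]. *)
Lemma quadratic_tail (k m theta C0 : R) :
  0 < k <= 1 -> 0 <= m -> 0 < theta -> 0 < C0 ->
  exists a A : R, 0 <= A /\
  forall (X : nat -> {RV P >-> R}) (n L : nat) (b : nat -> nat -> R),
  (0 < n)%N ->
  mutually_independent P (fun i => sigma_generated (fun _ : unit => X i)) ->
  (forall u, \int[P]_x X u x = 0) ->
  (forall u, \int[P]_x (evenpow (1 + k) (X u x ^+ 2))%:E <= m%:E)%E ->
  (forall u v, `|b u v| <= C0 * envelope_form theta n u v) ->
  (P [set x | (a * n%:R < `|\sum_(u < L) \sum_(v < L) b u v * X u x * X v x|)%R]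
    <= (A * n%:R `^ (- (1 + k)))%:E)%E.
Proof.
move=> k01 m0 th0 C00; have /andP[k0 k1] := k01.
pose C1 := 2 + (3 / 4 * theta)^-1.
pose G1 := 4 * C0 ^+ 2 * (2 * C1 ^+ 2 * (2 + (theta / 2)^-1)).
have G10 : 0 < G1.
  by rewrite !mulr_gt0 ?exprn_gt0 // ?addr_gt0 // invr_gt0 ?mulr_gt0 ?divr_gt0.
have [c hc] : exists c, 512 * (16 * (m + (1 + m) ^+ 4)) <= c.
  by eexists; exact: lexx.
have c0 : 0 <= c.
  apply: le_trans hc; apply: (mulr_ge0 (ler0n _ _)); apply: (mulr_ge0 (ler0n _ _)).
  by rewrite addr_ge0 // exprn_ge0 // addr_ge0.
pose D := 2 * c * 32 `^ k.
have D0 : 0 <= D by rewrite !mulr_ge0 // powR_ge0.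
exists (C0 * (1 + m) * C1 + 1), (2 * D * (2 * D + 1) * G1 `^ (1 + k)).
split; first by rewrite !mulr_ge0 ?addr_ge0 ?mulr_ge0 ?powR_ge0.
move=> X n L b n0 indep X0 Xm bC.
have nR : 0 < n%:R :> R by rewrite ltr0n.
pose s2 u := \int[P]_x (X u x ^+ 2).
pose S x := \sum_(u < L) \sum_(v < L) b u v * X u x * X v x -
  \sum_(u < L) b u u * s2 u.
have mX u : measurable_fun setT (X u : T -> R) by exact: measurable_funP.
have mform : measurable_fun setT
    (fun x => \sum_(u < L) \sum_(v < L) b u v * X u x * X v x).
  apply: measurable_sum => u; apply: measurable_sum => v.
  by apply: measurable_funM => //; apply: measurable_funM.
have mS : measurable_fun setT S by apply: measurable_funB.
have Gn0 : 0 < G1 * n%:R by rewrite mulr_gt0.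
have bG : \sum_(l < L) (b l l ^+ 2 + \sum_(u < l) (b u l + b l u) ^+ 2) <= G1 * n%:R.
  apply: (le_trans (dominated_coefficients L th0 bC)).
  by rewrite /G1 -[leRHS]mulrA.
have ES := quadratic_moment indep k01 (fun u => first_integrable k01 (Xm u)) X0
  (fun u => square_integrable k01 (Xm u)) (fun u => erefl (s2 u))
  (fun u => half_moment_le (Xm u))
  (fun u => centred_square_moment_le k01 (Xm u)) hc Gn0 bG.
have tr : `|\sum_(u < L) b u u * s2 u| <= C0 * (1 + m) * C1 * n%:R.
  apply: (le_trans (ler_norm_sum _ _ _)).
  have -> : C0 * (1 + m) * C1 * n%:R = C0 * (1 + m) * (C1 * n%:R) by ring.
  have := envelope_form_trace th0 n L; rewrite -/C1 => /(ler_wpM2l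
    (mulr_ge0 (ltW C00) (addr_ge0 ler01 m0))); apply: le_trans.
  rewrite mulr_sumr; apply: ler_sum => u _.
  have /andP[v0 v1] := variance_bounds k01 (Xm u).
  rewrite normrM (ger0_norm v0).
  have -> : C0 * (1 + m) * envelope_form theta n u u =
    C0 * envelope_form theta n u u * (1 + m) by ring.
  by apply: ler_pM.
pose e := evenpow (1 + k) n%:R.
have e0 : 0 < e by rewrite powR_gt0 // exprn_gt0.
apply: (@le_trans _ _ (P [set x | (e <= evenpow (1 + k) (S x))%R])).
  apply: le_measure; rewrite ?inE.
  - by apply: measurable_superlevel; exact: measurableT_comp.
  - have -> : [set x | e <= evenpow (1 + k) (S x)] =
        setT `&` (fun x => evenpow (1 + k) (S x)) @^-1` `[e, +oo[.
      by rewrite setTI; apply/seteqP; split => x /=; rewrite in_itv /= andbT.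
    by apply: measurable_evenpow.
  move=> x /= h; apply: evenpow_le; first by rewrite addr_ge0 // ltW.
  rewrite (ger0_norm (ltW nR)).
  have := ler_normB (S x) (- \sum_(u < L) b u u * s2 u).
  rewrite /S opprK subrK normrN -/(S x); move: h tr.
  by rewrite mulrDl mul1r; lra.
apply: (le_trans (markov_real _ _ e0 ES)).
- exact: measurable_evenpow.
- by move=> x; exact: evenpow_ge0.
rewrite lee_fin le_eqVlt; apply/orP; left; apply/eqP.
rewrite (powRM _ (ltW G10) (ltW nR)) powRN /e /evenpow expr2 powRM ?ltW //.
rewrite -/D; set z := n%:R `^ (1 + k).
have z0 : z != 0 by rewrite gt_eqF // powR_gt0.
by field.
Qed.

End QuadraticTail.

Section LimitsInProbability.
Context {R : realType} {disp : measure_display} {T : measurableType disp}.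
Variable P : probability T R.

Lemma independent_reindex (I J : choiceType) (F : I -> set (set T))
    (h : J -> I) (g : I -> J) :
  cancel h g -> mutually_independent P F ->
  mutually_independent P (fun j => F (h j)).
Proof.
move=> hg indF A E FE; have hinj := can_inj hg.
have := indF (h @` A)%fset (fun i => E (g i)).
have -> : \bigcap_(i in [set` (h @` A)%fset]) E (g i) = \bigcap_(j in [set` A]) E j.
  apply/seteqP; split => x Ex j /= jA.
    by rewrite -(hg j); apply: Ex; rewrite /= mem_imfset.
  by have /imfsetP[i iA ->] := jA; rewrite hg; exact: Ex.
move=> ->; last by move=> i /imfsetP[j jA ->]; rewrite hg; exact: FE.
rewrite big_imfset /=; last by move=> i j _ _; exact: hinj.
by congr (_%:E); apply: eq_bigr => j _; rewrite hg.
Qed.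

(** If the limit exceeds the level, so do all late terms. *)
Lemma ae_limit_tail (f : nat -> T -> R) (g : T -> R) (a e : R) :
  (forall n, measurable_fun setT (f n)) -> measurable_fun setT g ->
  {ae P, forall x, f ^~ x @ \oo --> g x} ->
  (forall n, P [set x | (a < `|f n x|)%R] <= e%:E)%E ->
  (P [set x | (a < `|g x|)%R] <= e%:E)%E.
Proof.
move=> mf mg fg fe.
pose A n := [set x | a < `|f n x|].
have mA n : measurable (A n).
  by apply: measurable_superlevel; exact: measurableT_comp.
pose B n := \bigcap_(j in [set j | (n <= j)%N]) A j.
have mB n : measurable (B n) by apply: bigcap_measurable => //; exists n => /=.
have mUB : measurable (\bigcup_n B n) by exact: bigcupT_measurable.
have ndB : nondecreasing_seq B.
  move=> i j ij; apply/subsetPset => x Bx l /= jl.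
  by apply: Bx; exact: leq_trans ij jl.
have PB : (P (\bigcup_n B n) <= e%:E)%E.
  have cB := nondecreasing_cvg_mu (mu := P) mB mUB ndB.
  rewrite -(cvg_lim (@ereal_hausdorff R) cB).
  apply: lime_le; first by apply/cvg_ex; exists (P (\bigcup_n B n)).
  apply: nearW => n /=; apply: le_trans (fe n).
  by apply: le_measure; rewrite ?inE //; [exact: mA|move=> x; apply => /=].
have mG : measurable [set x | a < `|g x|].
  by apply: measurable_superlevel; exact: measurableT_comp.
have [N [mN N0 subN]] := fg.
apply: (@le_trans _ _ (P (N `|` \bigcup_n B n))).
  apply: le_measure; rewrite ?inE //; first exact: measurableU.
  move=> x /= ax; have [cvx|ncvx] := pselect (f ^~ x @ \oo --> g x); last first.
    by left; exact: subN.
  right; have : \forall n \near \oo, a < `|f n x|.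
    exact: (cvgr_gt _ (cvg_norm cvx) _ ax).
  by case=> n _ h; exists n => // j /= nj; exact: h.
apply: (le_trans (measureU2 _ _ _)) => //.
rewrite -[leRHS]add0e; apply: leeD => //.
by move/eqP: N0; rewrite eq_le => /andP[].
Qed.

End LimitsInProbability.

Section LinearProcessTail.
Context {R : realType} {disp : measure_display} {T : measurableType disp}.
Variable P : probability T R.

(** The coefficient of the [u]-th innovation, counted backwards from time [n],
in coordinate [nu] of the observation at time [n - i]. *)
Definition shifted {d} (cf : 'I_d -> nat -> R) (nu : 'I_d) (i u : nat) : R :=
  if (i <= u)%N then cf nu (u - i)%N else 0.

Lemma shifted_sum {d} (cf : 'I_d -> nat -> R) (nu : 'I_d) (e : nat -> R) (i L : nat) :
  (i <= L)%N ->
  \sum_(u < L) shifted cf nu i u * e u = \sum_(0 <= j < L - i) cf nu j * e (i + j)%N.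
Proof.
move=> iL; rewrite -(big_mkord xpredT (fun u => shifted cf nu i u * e u)).
rewrite (big_cat_nat (leq0n i) iL) /= big_nat_cond big1 ?add0r; last first.
  by move=> u /andP[/andP[_ ui] _]; rewrite /shifted leqNgt ui mul0r.
rewrite -{1}(add0n i) big_addn; apply: eq_bigr => j _.
by rewrite /shifted leq_addl addnK addnC.
Qed.

(** The innovations are numbered backwards from time [n], so that the form in the
partial sums of the linear processes is a form in the first [L] of them; the
bound is uniform in [L] and survives the limit. *)
Lemma process_form_tail (k m theta c M : R) :
  0 < k <= 1 -> 0 <= m -> 0 < theta ->
  exists a A : R, 0 <= A /\
  forall (eps : int -> {RV P >-> R}) (n d : nat) (cf : 'I_d -> nat -> R)
    (q : 'I_d -> 'I_d -> R) (Y : nat -> 'I_d -> {RV P >-> R}),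
  (0 < n)%N ->
  mutually_independent P (fun t => sigma_generated (fun _ : unit => eps t)) ->
  (forall t, \int[P]_x eps t x = 0) ->
  (forall t, \int[P]_x (evenpow (1 + k) (eps t x ^+ 2))%:E <= m%:E)%E ->
  (forall nu j, `|cf nu j| <= c * decay (3 / 4 + theta / 2) j) ->
  \sum_nu \sum_mu `|q nu mu| <= M ->
  (forall i nu, {ae P, forall x,
       series (fun j : nat => cf nu j * eps (i%:Z - j%:Z) x) @ \oo
         --> Y i nu x}) ->
  (P [set x | (a * n%:R < `|\sum_(i < n) \sum_nu \sum_mu
       q nu mu * Y (n - i)%N nu x * Y (n - i)%N mu x|)%R]
    <= (A * n%:R `^ (- (1 + k)))%:E)%E.
Proof.
move=> k01 m0 th0.
pose C0 := `|M| * c ^+ 2 + 1.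
have C00 : 0 < C0 by rewrite ltr_wpDl // mulr_ge0 ?sqr_ge0.
have [a [A [A0 tail]]] := quadratic_tail P k01 m0 th0 C00.
exists a, A; split=> // eps n d cf q Y n0 indep eps0 epsm cfc qM Ycvg.
pose X (u : nat) := eps (n%:Z - u%:Z).
have indepX : mutually_independent P
    (fun i => sigma_generated (fun _ : unit => X i)).
  apply: (@independent_reindex _ _ _ P int nat
    (fun t => sigma_generated (fun _ : unit => eps t))
    (fun u => n%:Z - u%:Z) (fun t => `|n%:Z - t|%N)) indep.
  by move=> u; rewrite opprB addrC subrK absz_nat.
pose b u v := \sum_(i < n) \sum_nu \sum_mu
  q nu mu * (shifted cf nu i u * shifted cf mu i v).
have shift_le nu i u : `|shifted cf nu i u| <= c * envelope theta u i.
  by rewrite /shifted /envelope; case: ifP => // _; rewrite normr0 mulr0.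
have bC u v : `|b u v| <= C0 * envelope_form theta n u v.
  rewrite /b /envelope_form mulr_sumr; apply: (le_trans (ler_norm_sum _ _ _)).
  apply: ler_sum => i _.
  have ee : 0 <= envelope theta u i * envelope theta v i.
    by rewrite mulr_ge0 ?envelope_ge0.
  apply: (@le_trans _ _ (M * (c ^+ 2 * (envelope theta u i * envelope theta v i)))).
    apply: (@le_trans _ _ (\sum_nu \sum_mu `|q nu mu| *
        (c ^+ 2 * (envelope theta u i * envelope theta v i)))).
      apply: (le_trans (ler_norm_sum _ _ _)); apply: ler_sum => nu _.
      apply: (le_trans (ler_norm_sum _ _ _)); apply: ler_sum => mu _.
      rewrite normrM ler_wpM2l // normrM.
      have -> : c ^+ 2 * (envelope theta u i * envelope theta v i) =
        (c * envelope theta u i) * (c * envelope theta v i) by ring.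
      by apply: ler_pM.
    under eq_bigr do rewrite -mulr_suml.
    by rewrite -mulr_suml ler_wpM2r // mulr_ge0 ?sqr_ge0.
  rewrite mulrA ler_wpM2r // /C0.
  have := ler_wpM2r (sqr_ge0 c) (ler_norm M); lra.
pose Z L i nu x := \sum_(u < L) shifted cf nu i u * X u x.
have formE L x : \sum_(u < L) \sum_(v < L) b u v * X u x * X v x =
    \sum_(i < n) \sum_nu \sum_mu q nu mu * Z L i nu x * Z L i mu x.
  transitivity (\sum_(u < L) \sum_(v < L) \sum_(i < n) \sum_nu \sum_mu
     q nu mu * ((shifted cf nu i u * X u x) * (shifted cf mu i v * X v x))).
    apply: eq_bigr => u _; apply: eq_bigr => v _.
    rewrite /b !mulr_suml; apply: eq_bigr => i _.
    rewrite !mulr_suml; apply: eq_bigr => nu _.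
    by rewrite !mulr_suml; apply: eq_bigr => mu _; ring.
  under eq_bigr do rewrite exchange_big.
  rewrite exchange_big /=; apply: eq_bigr => i _.
  under eq_bigr do rewrite exchange_big.
  rewrite exchange_big /=; apply: eq_bigr => nu _.
  under eq_bigr do rewrite exchange_big.
  rewrite exchange_big /=; apply: eq_bigr => mu _.
  rewrite -mulrA /Z big_distrlr /= mulr_sumr; apply: eq_bigr => u _.
  by rewrite mulr_sumr.
have mX u : measurable_fun setT (X u : T -> R) by exact: measurable_funP.
have mY i nu : measurable_fun setT (Y i nu : T -> R) by exact: measurable_funP.
apply: (@ae_limit_tail _ _ _ P (fun L x =>
  \sum_(u < L) \sum_(v < L) b u v * X u x * X v x)).
- move=> L; apply: measurable_sum => u; apply: measurable_sum => v.
  by apply: measurable_funM => //; apply: measurable_funM.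
- apply: measurable_sum => i; apply: measurable_sum => nu.
  apply: measurable_sum => mu.
  by apply: measurable_funM => //; apply: measurable_funM.
- have allcvg : {ae P, forall x, forall i : 'I_n, forall nu,
      series (fun j : nat => cf nu j * eps ((n - i)%N%:Z - j%:Z) x) @ \oo
         --> Y (n - i)%N nu x}.
    by apply: filter_forall => i; apply: filter_forall => nu; exact: Ycvg.
  apply: filterS allcvg => x cvx.
  under eq_fun do rewrite formE.
  have Zcvg (i : 'I_n) nu : (fun L => Z L i nu x) @ \oo --> Y (n - i)%N nu x.
    apply: cvg_trans (cvg_comp _ _ (cvg_subnr i) (cvx i nu)).
    apply: near_eq_cvg; exists (i : nat) => // L /= iL.
    rewrite /Z (shifted_sum cf nu (fun u => X u x) iL) /series /=; apply: eq_bigr => j _.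
    by rewrite /X PoszD opprD addrA -subzn // ltnW.
  apply: cvg_big => [|i _]; first exact: add_continuous.
  apply: cvg_big => [|nu _]; first exact: add_continuous.
  apply: cvg_big => [|mu _]; first exact: add_continuous.
  by apply: cvgM => //; apply: cvgM => //; exact: cvg_cst.
- move=> L.
  exact: (tail X n L b n0 indepX (fun u => eps0 _) (fun u => epsm _) bC).
Qed.

End LinearProcessTail.

(** * Equality in law *)

Section EqualInLaw.
Context {R : realType} {disp disp' : measure_display}.
Context {T : measurableType disp} {T' : measurableType disp'}.
Variables (P : probability T R) (P' : probability T' R) (I : choiceType).
Variables (X : I -> {RV P >-> R}) (X' : I -> {RV P' >-> R}).

Definition pathType : measurableType
    (cylinders (fun (i : I) (f : I -> R) => f i) predT).-sigma :=
  g_sigma_algebraType (cylinders (fun (i : I) (f : I -> R) => f i) predT).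

Lemma measurable_coordinate i : measurable_fun [set: pathType] (fun f => f i).
Proof.
move=> _ E mE; rewrite setTI; apply: sub_sigma_algebra.
exact: cylinders_preimage.
Qed.

Lemma measurable_path d (U : measurableType d) (Z : I -> U -> R) :
  (forall i, measurable_fun setT (Z i)) ->
  measurable_fun [set: U] (fun x => (Z ^~ x) : pathType).
Proof.
move=> mZ; apply: (@measurability _ _ _ pathType _ _
  (cylinders (fun (i : I) (f : I -> R) => f i) predT)) => //.
move=> _ [_ [J [E [_ mE ->]]] <-]; rewrite setTI preimage_bigcap bigcap_fset.
elim/big_ind: _ => //; first exact: measurableI.
by move=> i _; rewrite -[X in measurable X]setTI; exact: mZ.
Qed.

Lemma same_distribution_event (E : set pathType) :
  same_distribution P P' (fun i => X i : T -> R) (fun i => X' i : T' -> R) ->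
  measurable E ->
  P [set x | E (X ^~ x)] = P' [set x | E (X' ^~ x)].
Proof.
move=> same mE.
have mX : measurable_fun [set: T] (fun x => (X ^~ x) : pathType).
  by apply: measurable_path => i; exact: measurable_funP.
have mX' : measurable_fun [set: T'] (fun x => (X' ^~ x) : pathType).
  by apply: measurable_path => i; exact: measurable_funP.
pose Phi : {RV P >-> pathType} := mfun_Sub (mem_set mX).
pose Phi' : {RV P' >-> pathType} := mfun_Sub (mem_set mX').
suff : distribution P Phi E = distribution P' Phi' E by [].
have h := @measure_unique _ R pathType
  (cylinders (fun (i : I) (f : I -> R) => f i) predT) (fun=> setT).
apply: (h _ _ _ _ (distribution P Phi) (distribution P' Phi')) => // {h}.
- exact: cylinders_setI.
- by move=> _; exact: cylinders_setT.
- by apply/seteqP; split => // x _; exists 0%N.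
- by move=> _ [J [F [_ mF ->]]]; exact: same.
- by move=> _; exact: le_lt_trans (probability_le1 P measurableT) (ltry _).
Qed.

End EqualInLaw.

(** * The difference of two shrinkage estimators *)

Section ShrinkageAlgebra.
Context {R : realType} {d : nat}.
Implicit Types (v w : 'cV[R]_d) (y : nat -> 'cV[R]_d).

(** The weights of the form [v' (mu I - S) w] in the entries of [S], with [mu]
the mean trace of [S]. *)
Definition contrast v w (nu mu : 'I_d) : R :=
  (v^T *m w) 0 0 / d%:R * (nu == mu)%:R - v nu 0 * w mu 0.

Lemma contrastE v w (S : 'M[R]_d) :
  (v^T *m (mean_trace S *: 1%:M - S) *m w) 0 0 =
  \sum_nu \sum_mu contrast v w nu mu * S nu mu.
Proof.
rewrite mulmxBr mulmxBl -scalemxAr mulmx1 -scalemxAl !mxE.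
under [RHS]eq_bigr do under eq_bigr do rewrite /contrast mulrBl.
under [RHS]eq_bigr do rewrite sumrB.
rewrite sumrB; congr (_ - _).
  transitivity ((v^T *m w) 0 0 / d%:R * \tr S).
    by rewrite /mean_trace !mxE; ring.
  rewrite /mxtrace mulr_sumr; apply: eq_bigr => nu _.
  rewrite (bigD1 nu) //= eqxx mulr1 big1 ?addr0 // => mu.
  by rewrite eq_sym => /negbTE ->; rewrite mulr0 mul0r.
rewrite exchange_big /=; apply: eq_bigr => mu _.
rewrite !mxE mulr_suml; apply: eq_bigr => nu _.
by rewrite !mxE; ring.
Qed.

Lemma shrinkage_difference v w y n (W1 W2 : R) :
  (v^T *m (shrinkage n y W1 - shrinkage n y W2) *m w) 0 0 =
  (W1 - W2) * (n%:R^-1 * \sum_(i < n) \sum_nu \sum_mu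
     contrast v w nu mu * y (n - i)%N nu 0 * y (n - i)%N mu 0).
Proof.
have -> : shrinkage n y W1 - shrinkage n y W2 =
    (W1 - W2) *: (mean_trace (sample_cov n y) *: 1%:M - sample_cov n y).
  by apply/matrixP => i j; rewrite !mxE; ring.
rewrite -scalemxAr -scalemxAl mxE contrastE; congr (_ * _).
have covE nu mu : sample_cov n y nu mu =
    n%:R^-1 * \sum_(i < n) y (n - i)%N nu 0 * y (n - i)%N mu 0.
  rewrite /sample_cov !mxE summxE; congr (_ * _).
  rewrite big_add1 /= big_mkord (reindex_inj rev_ord_inj) /=.
  apply: eq_bigr => i _; rewrite !mxE big_ord1 !mxE.
  by rewrite subnSK // subKn.
under eq_bigr do under eq_bigr do rewrite covE mulrCA mulr_sumr.
under eq_bigr do rewrite -mulr_sumr exchange_big /=.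
rewrite -mulr_sumr exchange_big /=; congr (_ * _).
apply: eq_bigr => i _; apply: eq_bigr => nu _; apply: eq_bigr => mu _.
by rewrite mulrA.
Qed.

(** The factor [1 / d] of the mean trace compensates the [d] diagonal terms, so the
bound does not involve the dimension. *)
Lemma contrast_bound v w (M : R) : (0 < d)%N ->
  l1_norm v <= M -> l1_norm w <= M ->
  \sum_nu \sum_mu `|contrast v w nu mu| <= 2 * M ^+ 2.
Proof.
move=> d0 vM wM; have dR : d%:R != 0 :> R by rewrite pnatr_eq0 -lt0n.
have norm0 (u : 'cV[R]_d) : 0 <= l1_norm u by apply: sumr_ge0.
have vw : l1_norm v * l1_norm w <= M ^+ 2 by rewrite expr2 ler_pM.
have ip : `|(v^T *m w) 0 0| <= l1_norm v * l1_norm w.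
  rewrite mxE (le_trans (ler_norm_sum _ _ _)) // /l1_norm mulr_suml.
  apply: ler_sum => i _; rewrite mxE normrM ler_wpM2l //.
  by rewrite (bigD1 i) //= lerDl sumr_ge0.
apply: (@le_trans _ _ (`|(v^T *m w) 0 0| + l1_norm v * l1_norm w)); last by lra.
have -> : `|(v^T *m w) 0 0| =
    \sum_(nu < d) \sum_(mu < d) `|(v^T *m w) 0 0| / d%:R * (nu == mu)%:R.
  under eq_bigr => nu _.
    rewrite (bigD1 nu) //= eqxx mulr1 big1 => [|mu]; first by rewrite addr0; over.
    by rewrite eq_sym => /negbTE ->; rewrite mulr0.
  by rewrite sumr_const card_ord -[RHS]mulr_natr divfK.
rewrite /l1_norm big_distrlr -big_split /=; apply: ler_sum => nu _.
rewrite -big_split /=; apply: ler_sum => mu _.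
rewrite (le_trans (ler_normB _ _)) // !normrM lerD2r.
by rewrite normfV !normr_nat.
Qed.

End ShrinkageAlgebra.

(** * Almost sure boundedness *)

Lemma fourth_power_moment (R : realType) (k delta x : R) :
  0 <= k -> 4 * k <= delta ->
  evenpow (1 + k) (x ^+ 2) <= 1 + `|x| `^ (4 + delta).
Proof.
move=> k0 kd.
have -> : evenpow (1 + k) (x ^+ 2) = `|x| `^ (4 * (1 + k)).
  rewrite powRrM powR_mulrn // /evenpow; congr (_ `^ _).
  by rewrite -exprM -[LHS]ger0_norm ?exprn_even_ge0 // normrX.
have p0 := powR_ge0 `|x| (4 + delta).
have [x1|/ltW x1] := leP `|x| 1.
  apply: (@le_trans _ _ 1); last by rewrite lerDl.
  have := @ge0_ler_powR R (4 * (1 + k)) _ `|x| 1; rewrite powR1; apply => //.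
    by rewrite mulr_ge0 // addr_ge0.
  by rewrite nnegrE.
apply: (@le_trans _ _ (`|x| `^ (4 + delta))); last by rewrite lerDr.
by apply: ler_powR => //; lra.
Qed.

Lemma coefficient_envelope (R : realType) (c theta a : R) (j : nat) :
  `|a| ^+ 2 <= c * (maxn j 1)%:R `^ (- (3 / 2) - theta) ->
  `|a| <= Num.sqrt `|c| * decay (3 / 4 + theta / 2) j.
Proof.
move=> ac; have b0 : 0 <= Num.sqrt `|c| * decay (3 / 4 + theta / 2) j.
  by rewrite mulr_ge0 ?sqrtr_ge0 ?decay_ge0.
rewrite -(@ler_pXn2r _ 2) ?nnegrE // exprMn sqr_sqrtr //.
have -> : decay (3 / 4 + theta / 2) j ^+ 2 =
    (maxn j 1)%:R `^ (- (3 / 2) - theta) :> R.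
  by rewrite expr2 -decayD /decay; congr (_ `^ _); field.
apply: (le_trans ac); rewrite ler_wpM2r ?powR_ge0 //; exact: ler_norm.
Qed.

Lemma ae_eventually_bounded (R : realType) (disp : measure_display)
    (T : measurableType disp) (P : probability T R) (f : nat -> T -> R)
    (a A k : R) : 0 < k -> 0 <= A -> (forall n, measurable_fun setT (f n)) ->
  (forall n, (0 < n)%N ->
    (P [set x | (a * n%:R < `|f n x|)%R] <= (A * n%:R `^ (- (1 + k)))%:E)%E) ->
  {ae P, forall x, exists N, forall n, (N <= n)%N -> (0 < n)%N ->
     `|f n x| <= a * n%:R}.
Proof.
move=> k0 A0 mf tail.
(* The tail bound says nothing at [n = 0]. *)
pose F n := if n is 0 then set0 else [set x | a * n%:R < `|f n x|].
have mF n : measurable (F n).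
  case: n => [|n]; first exact: measurable0.
  by apply: measurable_superlevel; exact: measurableT_comp.
have sumF : (\sum_(n <oo) P (F n) < +oo)%E.
  apply: (@le_lt_trans _ _ (A * (2 + k^-1))%:E); last exact: ltry.
  apply: lime_le; first by apply: is_cvg_nneseries => n _ _; exact: measure_ge0.
  apply: nearW => N; apply: (@le_trans _ _ (\sum_(0 <= n < N) (A * decay (1 + k) n)%:E)%E).
    apply: lee_sum => -[_|n _].
      by rewrite /F measure0 lee_fin mulr_ge0 ?decay_ge0.
    by rewrite /decay (maxn_idPl _) //; exact: tail.
  rewrite sumEFin lee_fin -mulr_sumr ler_wpM2l // big_mkord.
  exact: sum_decay.
exists (lim_sup_set F); split.
- by apply: bigcap_measurable => // n _; exact: bigcup_measurable.
- exact: (lim_sup_set_cvg0 mF sumF).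
move=> x /= nx n _; apply: contrapT => h; apply: nx.
exists n => l nl l0; rewrite leNgt; apply/negP => hl; apply: h.
by exists l => //; case: l l0 hl {nl}.
Qed.


Theorem theorem4p3 (R : realType)
  (disp : measure_display) (T : measurableType disp) (P : probability T R)
  (eps : int -> {RV P >-> R}) (delta : R)
  (eps_indep : mutually_independent P
     (fun t => sigma_generated (fun _ : unit => eps t)))
  (eps_mean : forall t, 'E_P[eps t]%E = 0%:E)
  (delta_gt0 : 0 < delta)
  (eps_moment :
     (ereal_sup (range (fun t => 'E_P[(fun x => `|eps t x| `^ (4 + delta))%R]))
      < +oo)%E)
  (eps_cesaro : forall r : nat, (2 <= r <= 4)%N ->
     cvgn (fun n : nat =>
       n%:R^-1 * \sum_(1 <= i < n.+1) mean P (fun x => eps i%:Z x ^+ r)))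
  (dim : nat -> nat) (dim_gt0 : forall n, (0 < n)%N -> (0 < dim n)%N)
  (cf : forall n, 'I_(dim n) -> nat -> R) (theta : R)
  (theta_itv : 0 < theta < 1 / 2)
  (cf_decay : exists c : R, forall (n : nat) (nu : 'I_(dim n)) (j : nat),
     (0 < n)%N ->
     `|cf n nu j| ^+ 2 <= c * (maxn j 1)%:R `^ (- (3 / 2) - theta))
  (Y : forall n, nat -> 'I_(dim n) -> {RV P >-> R})
  (Y_linear : forall (n i : nat) (nu : 'I_(dim n)), (0 < n)%N ->
     {ae P, forall x,
       series (fun j : nat => cf n nu j * eps (i%:Z - j%:Z) x) @ \oo
         --> Y n i nu x})
  (beta2 : forall n, 'cV[R]_(dim n) -> 'cV[R]_(dim n) ->
                     'cV[R]_(dim n) -> 'cV[R]_(dim n) -> R)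
  (beta2_def : forall (n : nat) (v w v' w' : 'cV[R]_(dim n)), (0 < n)%N ->
     is_beta2 (cf n) theta
       (fun k => mean P (fun x => eps k%:Z x ^+ 2))
       (fun k => mean P (fun x => eps k%:Z x ^+ 4))
       v w v' w' (beta2 n v w v' w'))
  (v w : forall n, 'cV[R]_(dim n))
  (vw_bounded : exists M : R, forall n, (0 < n)%N ->
     Num.max (l1_norm (v n)) (l1_norm (w n)) <= M)
  (vw_lower : exists c : R, 0 < c /\
     forall n, (0 < n)%N -> c <= ((v n)^T *m w n) 0 0)
  (sigma_tr_inf : exists c : R, 0 < c /\
     forall n, (0 < n)%N ->
       c <= (dim n)%:R ^- 2 *
            \sum_(i < dim n) \sum_(j < dim n)
              beta2 n (unit_vec i) (unit_vec i) (unit_vec j) (unit_vec j))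
  (disp' : measure_display) (T' : measurableType disp') (P' : probability T' R)
  (Y' : forall n, nat -> 'I_(dim n) -> {RV P' >-> R})
  (Y'_version : forall n, (0 < n)%N ->
     same_distribution P P'
       (fun k : nat * 'I_(dim n) => Y n k.1 k.2)
       (fun k : nat * 'I_(dim n) => Y' n k.1 k.2))
  (B : forall n, R -> 'I_(dim n).+1 -> {RV P' >-> R})
  (C : nat -> {RV P' >-> R}) (lambda : nat -> R)
  (rate : rate_condition Y' beta2 v w B C lambda)
  (m : nat -> nat) (win : nat -> nat -> R) :
  exists (K : R) (A1 A2 A3 r : nat -> T' -> R),
    {ae P', forall x,
      [/\ forall n, (0 < n)%N ->
            [/\ `|A1 n x| <= K,
                `|A2 n x| <=
                  K * `|Bbar n (B n) 1 ord0 x * (Num.sqrt n%:R)^-1| &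
                `|A3 n x| <=
                  K * `|(Num.sqrt n%:R)^-1 * (Num.sqrt (dim n)%:R)^-1 *
                        \sum_(i < dim n) Bbar n (B n) 1 (lift ord0 i) x|],
          (fun n => Num.sqrt n%:R * r n x) @ \oo --> 0 &
          forall n, (0 < n)%N ->
            let y := obs (Y' n) x in
            let What := W_hat win (m n) n y in
            let Wopt := W_opt P' n (obs (Y' n)) in
            `| ((v n)^T *m (shrinkage n y What - shrinkage n y Wopt)
                 *m w n) 0 0 |
            = `|What - Wopt| * (A1 n x + A2 n x + A3 n x + r n x)]}.
Proof.
have /andP[th0 _] := theta_itv.
have [c hc] := cf_decay; have [M hM] := vw_bounded.
pose k := Num.min (delta / 4) 1.
have k01 : 0 < k <= 1 by rewrite lt_min divr_gt0 // ltr01 ge_min lexx orbT.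
have /andP[k0 _] := k01.
have kd : 4 * k <= delta by rewrite -ler_pdivlMl // mulrC ge_min lexx.
set m4 := ereal_sup _ in eps_moment.
have m4E t : ('E_P[(fun x => `|eps t x| `^ (4 + delta))%R] <= m4)%E.
  by apply: ereal_sup_ubound; exists t.
have m40 : (0 <= m4)%E.
  by apply: le_trans (m4E 0); apply: expectation_ge0 => x; exact: powR_ge0.
have m4fin : m4 \is a fin_num by rewrite ge0_fin_numE.
pose mm := 1 + fine m4.
have mm0 : 0 <= mm by rewrite addr_ge0 // fine_ge0.
have mE t : measurable_fun setT (eps t : T -> R) by exact: measurable_funP.
have eps_mm t : (\int[P]_x (evenpow (1 + k) (eps t x ^+ 2))%:E <= mm%:E)%E.
  have mpow : measurable_fun setT (fun x => `|eps t x| `^ (4 + delta)).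
    apply: (measurableT_comp (measurable_powR _)).
    exact: measurableT_comp (mE t).
  apply: (@le_trans _ _ (\int[P]_x (1 + `|eps t x| `^ (4 + delta))%:E)%E).
    apply: ge0_le_integral => //.
    - by move=> x _; rewrite lee_fin evenpow_ge0.
    - exact/measurable_EFinP/measurable_evenpow/measurable_funX.
    - by apply/measurable_EFinP; apply: measurable_funD.
    move=> x _; rewrite lee_fin; apply: fourth_power_moment => //; exact: ltW.
  under eq_integral do rewrite EFinD.
  rewrite ge0_integralD //; last exact/measurable_EFinP.
  rewrite /mm EFinD fineK //; apply: leeD.
    rewrite (integral_cst P measurableT) -[leRHS]mule1.
    by apply: lee_wpmul2l => //; exact: probability_le1.
  by have := m4E t; rewrite unlock.
have eps0 t : \int[P]_x eps t x = 0.
  by have := eps_mean t; rewrite unlock /Rintegral => ->.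
pose q n := contrast (v n) (w n).
have qM n : (0 < n)%N -> \sum_nu \sum_mu `|q n nu mu| <= 2 * M ^+ 2.
  move=> n0; have := hM n n0; rewrite ge_max => /andP[vM wM].
  by apply: contrast_bound => //; exact: dim_gt0.
have [a [A [A0 tail]]] := process_form_tail P (Num.sqrt `|c|) (2 * M ^+ 2) k01 mm0 th0.
pose Q n x := \sum_(i < n) \sum_nu \sum_mu
  q n nu mu * Y' n (n - i)%N nu x * Y' n (n - i)%N mu x.
have mQ n : measurable_fun setT (Q n).
  have mY' i nu : measurable_fun setT (Y' n i nu : T' -> R).
    exact: measurable_funP.
  apply: measurable_sum => i; apply: measurable_sum => nu.
  apply: measurable_sum => mu.
  by apply: measurable_funM => //; apply: measurable_funM.
(* The tail bound concerns the law of [Y n] alone, which [Y' n] shares. *)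
have tail' n : (0 < n)%N ->
    (P' [set x | (a * n%:R < `|Q n x|)%R] <= (A * n%:R `^ (- (1 + k)))%:E)%E.
  move=> n0.
  pose form (f : nat * 'I_(dim n) -> R) := \sum_(i < n) \sum_nu \sum_mu
    q n nu mu * f ((n - i)%N, nu) * f ((n - i)%N, mu).
  have mform : measurable [set f : @pathType R (nat * 'I_(dim n))%type |
      a * n%:R < `|form f|].
    apply: measurable_superlevel; apply: measurableT_comp => //.
    apply: measurable_sum => i; apply: measurable_sum => nu.
    apply: measurable_sum => mu.
    by apply: measurable_funM; [apply: measurable_funM => //|];
      exact: measurable_coordinate.
  have := same_distribution_event
    (X := fun kk : nat * 'I_(dim n) => Y n kk.1 kk.2)
    (X' := fun kk : nat * 'I_(dim n) => Y' n kk.1 kk.2) (Y'_version n n0) mform.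
  rewrite /= => <-.
  apply: (tail eps n (dim n) (cf n) (q n) (Y n)) => //.
  - by move=> nu j; apply: coefficient_envelope; exact: hc.
  - exact: qM.
  - by move=> i nu; exact: Y_linear.
have bounded := ae_eventually_bounded k0 A0 mQ tail'.
pose Qbar n x := `|n%:R^-1 * Q n x|.
(* [`|a|] is a nonnegative bound for large [n]; the excess over it vanishes then. *)
exists `|a|, (fun n x => Num.min (Qbar n x) `|a|), (fun _ _ => 0), (fun _ _ => 0),
  (fun n x => Qbar n x - Num.min (Qbar n x) `|a|).
apply: filterS bounded => x [N hN]; split.
- move=> n n0; rewrite normr0; split; rewrite ?mulr_ge0 //.
  by rewrite ger0_norm ?ge_min ?lexx ?orbT // le_min !normr_ge0.
- apply: cvg_near_cst; exists N.+1 => // n /= Nn.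
  have n0 : (0 < n)%N by exact: leq_ltn_trans Nn.
  have nR : 0 < n%:R :> R by rewrite ltr0n.
  suff -> : Num.min (Qbar n x) `|a| = Qbar n x by rewrite subrr mulr0.
  apply/min_idPl; rewrite /Qbar normrM normfV (ger0_norm (ltW nR)).
  rewrite ler_pdivrMl // mulrC (le_trans (hN n (ltnW Nn) n0)) //.
  by rewrite ler_wpM2r ?ler_norm // ltW.
move=> n n0 /=; rewrite !addr0 subrKC shrinkage_difference normrM.
congr (_ * `|_ * _|); apply: eq_bigr => i _; apply: eq_bigr => nu _.
by apply: eq_bigr => mu _; rewrite !mxE.
Qed.
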